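(* Let $I=\{1\le i_1<\dots<i_k\le n\}$ be the pivot indices (the indices of the boundary sources) for the plabic network $(\mathcal N,\mathcal O,\mathfrak l)$. Let $E_e$ be the system of edge vectors on $(\mathcal N,\mathcal O,\mathfrak l)$ satisfying the boundary conditions $E_j$ (the $j$-th canonical basis vector) at the boundary sinks $b_j$, $j\in\bar I=[n]\setminus I$. Assume that we change the orientation along a simple closed directed cycle $\mathcal Q_0$ and let $(\mathcal N,\hat{\mathcal O},\mathfrak l)$ be the newly oriented network. Then the system of vectors $$\hat E_e=\begin{cases}(-1)^{\gamma(e)}E_e&\text{if }e\notin\mathcal Q_0,\\ \dfrac{(-1)^{\gamma(e)}}{w_e}E_e&\text{if }e\in\mathcal Q_0,\end{cases}$$ is the system of edge vectors on $(\mathcal N,\hat{\mathcal O},\mathfrak l)$ satisfying the same boundary conditions $E_j$ at the boundary sinks $j\in\bar I$.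
   Context: Networks. Fix positive integers $k<n$. A plabic graph $\mathcal G$ of type $(k,n)$ is a finite directed graph drawn planarly in a disk, with no component isolated from the boundary, such that: it has $n$ boundary vertices $b_1,\dots,b_n$ labelled clockwise, all on a common straight interval of the boundary of the disk, each of degree 1 (a boundary source if its edge is outgoing, a boundary sink if incoming; exactly $k$ are sources); all other (internal) vertices are strictly inside the disk and are bivalent or trivalent; each internal vertex either has exactly one incoming edge (white) or exactly one outgoing edge (black), bivalent vertices being assigned either colour. Edges are straight segments, regarded as vectors directed by the orientation. A plabic network $\mathcal N$ is a plabic graph with a positive weight $w_e$ on each edge; $\mathcal O$ denotes its orientation. Gauge rays. A gauge ray direction $\mathfrak l$ is an oriented direction such that the ray in direction $\mathfrak l$ from any boundary vertex points inside the disk, no internal edge is parallel to $\mathfrak l$, and the rays starting at boundary vertices contain no internal vertices. The gauge rays are the rays $\mathfrak l_{i_r}$ starting at the boundary sources. For plane vectors $s(u,v)=+1,0,-1$ if $(u,v)$ is positively (counterclockwise) oriented, parallel, negatively oriented. For consecutive edges, $\mathrm{wind}(e,f)=\pm1$ if $s(e,f)=s(e,\mathfrak l)=s(\mathfrak l,f)=\pm1$, and $0$ otherwise. $\mathrm{int}(e)$ is the number of intersections of $e$ with the gauge rays (the common starting point of $\mathfrak l_{i_r}$ and the edge at $b_{i_r}$ is not counted). System of edge vectors. The system of edge vectors with boundary conditions $B_j$ at the sinks is the unique solution of: $E_{e_j}=(-1)^{\mathrm{int}(e_j)}w_{e_j}B_j$ at the edge $e_j$ ending at each boundary sink $b_j$;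 $E_e=(-1)^{\mathrm{int}(e)+\mathrm{wind}(e,f)}w_eE_f$ for each incoming edge $e$ at a bivalent or black vertex with outgoing edge $f$; $E_{e_3}=(-1)^{\mathrm{int}(e_3)+\mathrm{wind}(e_3,e_1)}w_{e_3}E_{e_1}+(-1)^{\mathrm{int}(e_3)+\mathrm{wind}(e_3,e_2)}w_{e_3}E_{e_2}$ at each trivalent white vertex with incoming edge $e_3$ and outgoing edges $e_1,e_2$. Change of orientation. All edges of $\mathcal Q_0$ are reversed and their weights replaced by the reciprocals; other edges and weights are unchanged. A reversed edge is identified with the original one; $w_e$ in the formula is the initial weight. Index $\gamma$, computed in the initial orientation. The cycle $\mathcal Q_0$ divides the disk into two regions: the external one is marked $+$ and the internal one $-$. If $e\notin\mathcal Q_0$, $\gamma(e)=0$ (resp. $1$) if the starting vertex of $e$ belongs to the $+$ (resp. $-$) region, where a starting vertex on $\mathcal Q_0$ is first shifted infinitesimally in the direction of $e$. If $e\in\mathcal Q_0$, $\gamma(e)=\gamma_1(e)+\gamma_2(e)+\mathrm{int}(e)$, with $\gamma_1(e)=0$ (resp. $1$) if the region to the left of $e$ near its ending point is marked $+$ (resp. $-$), and $\gamma_2(e)=\frac{1-s(e,\mathfrak l)}2$. *)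

(* Defs.v *)
From HB Require Import structures.
From mathcomp Require Import all_boot all_order all_algebra.
From mathcomp Require Import all_classical all_reals all_analysis.

Set Implicit Arguments.
Unset Strict Implicit.
Unset Printing Implicit Defensive.

Import Order.TTheory GRing.Theory Num.Theory.
Import numFieldNormedType.Exports.

Local Open Scope classical_set_scope.
Local Open Scope ring_scope.

Section Plane.
Variable R : realType.
Notation point := (R * R)%type.

Definition cross (u v : point) : R := u.1 * v.2 - u.2 * v.1.

Definition orient (u v : point) : int := sgz (cross u v).

Definition left_normal (u : point) : point := (- u.2, u.1).

Definition segment (p q : point) : set point :=
  [set p + t *: (q - p) | t in [set t : R | 0 <= t <= 1]].

(* A closed disk in the plane: image of the closed round unit disk by a
   homeomorphism of the plane.  By Schoenflies' theorem this is the same as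
   being a subset of the plane homeomorphic to the closed unit disk. *)
Definition is_disk (D : set point) : Prop :=
  exists h g : point -> point,
    [/\ continuous h, continuous g, cancel h g, cancel g h &
        D = h @` [set x : point | x.1 ^+ 2 + x.2 ^+ 2 <= 1]].

(* The open interval ]p, q[ is part of the boundary of D, and the interior of D
   lies to the right when going from p to q, that is, the boundary of D is
   traversed clockwise. *)
Definition clockwise_boundary_interval (D : set point) (p q : point) : Prop :=
  p != q /\
  forall t : R, 0 < t < 1 ->
    \forall y \near p + t *: (q - p), D y <-> cross (q - p) (y - p) <= 0.

Definition winding (e f l : point) : int :=
  if (orient e f == orient e l) && (orient e f == orient l f)
  then orient e f else 0.

End Plane.

(* Raw data of a network drawn in the plane: vertices are the boundary vertices
   inl j, with j : 'I_n standing for the label j + 1, and the internal vertices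
   inr v.  The axioms are in is_plabic_network below. *)
Record network (R : realType) (n : nat) := Network {
  ivertex : finType;
  edge : finType;
  src : edge -> 'I_n + ivertex;
  tgt : edge -> 'I_n + ivertex;
  white : pred ivertex;  (* black vertices are those which are not white *)
  weight : edge -> R;
  disk : set (R * R);
  pos : 'I_n + ivertex -> R * R }.

Section Network.
Variables (R : realType) (n : nat).
Implicit Types (N : network R n) (l : R * R).

Definition vertex N : finType := ('I_n + ivertex N)%type.

Definition vec N (e : edge N) : R * R := pos (tgt e) - pos (src e).
Definition edge_segment N (e : edge N) : set (R * R) :=
  segment (pos (src e)) (pos (tgt e)).

Definition indeg N (v : vertex N) : nat := #|[pred e : edge N | tgt e == v]|.
Definition outdeg N (v : vertex N) : nat := #|[pred e : edge N | src e == v]|.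
Definition degree N (v : vertex N) : nat := (indeg v + outdeg v)%N.

Definition adjacent N : rel (vertex N) := fun u v =>
  [exists e : edge N, ((src e == u) && (tgt e == v)) ||
                      ((src e == v) && (tgt e == u))].

(* the set I of the indices of the boundary sources *)
Definition pivots N : {set 'I_n} := [set j | [exists e : edge N, src e == inl j]].

Record is_plabic_network (k : nat) N : Prop := IsPlabicNetwork {
  pn_disk : is_disk (disk N);
  pn_boundary : exists (p q : R * R) (t : 'I_n -> R),
    [/\ clockwise_boundary_interval (disk N) p q,
        forall i, 0 < t i < 1,
        forall i j : 'I_n, (i < j)%N -> t i < t j &
        forall i, pos (inl i : vertex N) = p + t i *: (q - p)];
  pn_internal : forall v : ivertex N, (disk N)° (pos (inr v : vertex N));
  pn_edge_in_disk : forall e : edge N, edge_segment e `<=` disk N;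
  pn_pos_inj : injective (@pos R n N);
  pn_no_loop : forall e : edge N, src e != tgt e;
  pn_planar : forall (e f : edge N) (x : R * R), e != f ->
    edge_segment e x -> edge_segment f x ->
    exists v : vertex N, [/\ x = pos v, v \in [:: src e; tgt e] &
                             v \in [:: src f; tgt f]];
  pn_not_isolated : forall v : vertex N,
    exists j : 'I_n, connect (@adjacent N) v (inl j);
  pn_boundary_degree : forall j : 'I_n, degree (inl j : vertex N) = 1%N;
  pn_sources : #|pivots N| = k;
  pn_internal_degree : forall v : ivertex N,
    degree (inr v : vertex N) = 2%N \/ degree (inr v : vertex N) = 3%N;
  pn_white : forall v : ivertex N, white v -> indeg (inr v : vertex N) = 1%N;
  pn_black : forall v : ivertex N, ~~ white v -> outdeg (inr v : vertex N) = 1%N;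
  pn_weight : forall e : edge N, 0 < weight e }.

(* The starting point is left out: a gauge ray meets an edge there only if the
   edge is the one at its boundary vertex, and this is not counted. *)
Definition open_ray N l (j : 'I_n) : set (R * R) :=
  [set pos (inl j : vertex N) + t *: l | t in [set t : R | 0 < t]].

(* In gd_not_parallel, an internal edge is one joining two internal vertices. *)
Record is_gauge_direction N l : Prop := IsGaugeDirection {
  gd_neq0 : l != 0;
  gd_inside : forall j : 'I_n,
    \forall t \near 0^'+, (disk N)° (pos (inl j : vertex N) + t *: l);
  gd_not_parallel : forall (e : edge N) (u v : ivertex N),
    src e = inr u -> tgt e = inr v -> orient (vec e) l != 0;
  gd_no_vertex : forall (j : 'I_n) (v : ivertex N),
    ~ open_ray N l j (pos (inr v : vertex N)) }.

(* No edge is parallel to l (for an edge at a boundary vertex this follows from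
   gd_inside and gd_no_vertex), so an edge meets a gauge ray at most once and
   the intersections are counted by the gauge rays that meet the edge. *)
Definition nb_int N l (e : edge N) : nat :=
  #|[set j in pivots N | `[< edge_segment e `&` open_ray N l j !=set0 >]]|.

Definition wind N l (e f : edge N) : int := winding (vec e) (vec f) l.

Definition edge_coef N l (e f : edge N) : R :=
  (-1) ^ ((nb_int l e)%:Z + wind l e f) * weight e.

Record edge_relations N l (B : 'I_n -> 'rV[R]_n) (E : edge N -> 'rV[R]_n) : Prop :=
  EdgeRelations {
  er_sink : forall (e : edge N) (j : 'I_n), tgt e = inl j ->
    E e = ((-1) ^+ nb_int l e * weight e) *: B j;
  er_bivalent_or_black : forall (v : ivertex N) (e f : edge N),
    degree (inr v : vertex N) = 2%N \/ ~~ white v ->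
    tgt e = inr v -> src f = inr v ->
    E e = edge_coef l e f *: E f;
  er_trivalent_white : forall (v : ivertex N) (e3 e1 e2 : edge N),
    degree (inr v : vertex N) = 3%N -> white v ->
    tgt e3 = inr v -> src e1 = inr v -> src e2 = inr v -> e1 != e2 ->
    E e3 = edge_coef l e3 e1 *: E e1 + edge_coef l e3 e2 *: E e2 }.

Definition is_edge_vector_system N l (B : 'I_n -> 'rV[R]_n)
    (E : edge N -> 'rV[R]_n) : Prop :=
  unique (edge_relations l B) E.

Definition simple_directed_cycle N (Q : seq (edge N)) : Prop :=
  [/\ Q != [::], cycle (fun e f => tgt e == src f) Q & uniq (map (@src R n N) Q)].

Definition reverse_cycle N (Q : seq (edge N)) : network R n :=
  {| ivertex := ivertex N;
     edge := edge N;
     src := fun e => if e \in Q then tgt e else src e;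
     tgt := fun e => if e \in Q then src e else tgt e;
     white := @white R n N;
     weight := fun e => if e \in Q then (weight e)^-1 else weight e;
     disk := disk N;
     pos := @pos R n N |}.

Definition cycle_curve N (Q : seq (edge N)) : set (R * R) :=
  [set x | exists2 e, e \in Q & edge_segment e x].

(* the internal region of the cycle, marked - ; the rest of the complement of
   the cycle, in the unbounded component, is the external region, marked + *)
Definition internal_region N (Q : seq (edge N)) : set (R * R) :=
  [set x | ~ cycle_curve Q x /\
           bounded_set (connected_component (~` cycle_curve Q) x)].

Definition starts_in_internal N (Q : seq (edge N)) (e : edge N) : Prop :=
  if `[< cycle_curve Q (pos (src e)) >]
  then \forall t \near 0^'+, internal_region Q (pos (src e) + t *: vec e)
  else internal_region Q (pos (src e)).

(* the points slightly to the left of e, close to its ending point *)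
Definition left_end_in_internal N (Q : seq (edge N)) (e : edge N) : Prop :=
  \forall d \near 0^'+, \forall t \near 0^'+,
    internal_region Q (pos (tgt e) - d *: vec e + t *: left_normal (vec e)).

Definition gamma1 N (Q : seq (edge N)) (e : edge N) : int :=
  if `[< left_end_in_internal Q e >] then 1 else 0.

Definition gamma2 N l (e : edge N) : int := ((1 - orient (vec e) l) %/ 2)%Z.

Definition gamma N l (Q : seq (edge N)) (e : edge N) : int :=
  if e \in Q then gamma1 Q e + gamma2 l e + (nb_int l e)%:Z
  else if `[< starts_in_internal Q e >] then 1 else 0.

Definition hat_vectors N l (Q : seq (edge N)) (E : edge N -> 'rV[R]_n)
    (e : edge N) : 'rV[R]_n :=
  if e \in Q then ((-1) ^ gamma l Q e / weight e) *: E e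
  else (-1) ^ gamma l Q e *: E e.

Definition canonical_vector (j : 'I_n) : 'rV[R]_n := delta_mx ord0 j.

End Network.

(* Main.v *)
(** The relations are rewritten vertex by vertex: at each vertex, the relation of
    [E] in the original network and the relation of [hat_vectors l Q E] in the
    reversed one differ by a nonzero factor.  Since every vector assignment on the
    reversed network is of the form [hat_vectors l Q E], solutions correspond
    bijectively and uniqueness is transported.

    Away from the cycle this only needs that [gamma] is constant around a vertex,
    that is, that an edge off the cycle stays in one region, and that boundary
    vertices are external (the complement of the disk is connected and unbounded).
    On the cycle, the signs at a vertex with consecutive cycle edges [e], [f] and
    third edge [h] reduce to a finite check on the orientations of [e], [f], [h]
    and [l]; what enters from the plane is that the two sides of the cycle lie in
    different regions, that is, the Jordan curve theorem for polygons.

    No side of the cycle is parallel to [l], so the parity of the number of sides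
    crossed by the ray in direction [l] is locally constant off the cycle, is even
    far away and changes across each side.  Walking along the cycle shows that all
    points close to it on the left lie in one component, and likewise on the right;
    one of the two components contains the points above a topmost vertex and is
    unbounded, the other one has odd parity and is bounded. *)

Require Import Defs.
From HB Require Import structures.
From mathcomp Require Import all_boot all_order all_algebra.
From mathcomp Require Import all_classical all_reals all_analysis.
From mathcomp Require Import ring lra.

Set Implicit Arguments.
Unset Strict Implicit.
Unset Printing Implicit Defensive.

Import Order.TTheory GRing.Theory Num.Theory.
Import numFieldNormedType.Exports.

Local Open Scope classical_set_scope.
Local Open Scope ring_scope.

(** * Plane vectors and segments *)

(** Which side of the cycle is internal is one global bit [b], and it has to disappear from the
    local sign checks. It does: modulo 2, [b] plus the truth value of [left_sector e f d == b] is
    the negation of the sector test, so the contribution of [gamma1] cancels against the choice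
    hidden in the region index of the third edge. The intersection numbers cancel as well: this is
    why [gamma] contains [nb_int] on the cycle, the coefficients supplying every other copy. Only
    signs of cross products of the three edges and [l] remain.

    The left of a path at a corner is not a half-plane in general, hence [left_sector]. The right
    side is obtained as the left side of the reversed polygon. For the parity, the delicate points
    are those level with a vertex: there single sides do switch, and correction terms that cancel
    around the polygon restore local constancy. *)

Section PlaneVectors.
Variable R : realType.
Local Notation point := (R * R)%type.
Implicit Types (u v w p q x y z : point) (s t r : R).

Lemma pair_coord u v : u.1 = v.1 -> u.2 = v.2 -> u = v.
Proof. by case: u v => [a b] [c d] /= -> ->. Qed.

Lemma add_coord1 u v : (u + v).1 = u.1 + v.1. Proof. by []. Qed.
Lemma add_coord2 u v : (u + v).2 = u.2 + v.2. Proof. by []. Qed.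
Lemma opp_coord1 u : (- u).1 = - u.1. Proof. by []. Qed.
Lemma opp_coord2 u : (- u).2 = - u.2. Proof. by []. Qed.
Lemma scale_coord1 t u : (t *: u).1 = t * u.1. Proof. by []. Qed.
Lemma scale_coord2 t u : (t *: u).2 = t * u.2. Proof. by []. Qed.

Definition coordE := (add_coord1, add_coord2, opp_coord1, opp_coord2,
  scale_coord1, scale_coord2).

Lemma crossDl u v w : cross (u + v) w = cross u w + cross v w.
Proof. by rewrite /cross !coordE; ring. Qed.
Lemma crossDr u v w : cross w (u + v) = cross w u + cross w v.
Proof. by rewrite /cross !coordE; ring. Qed.
Lemma crossNl u v : cross (- u) v = - cross u v.
Proof. by rewrite /cross !coordE; ring. Qed.
Lemma crossNr u v : cross u (- v) = - cross u v.
Proof. by rewrite /cross !coordE; ring. Qed.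
Lemma crossZl t u v : cross (t *: u) v = t * cross u v.
Proof. by rewrite /cross !coordE; ring. Qed.
Lemma crossZr t u v : cross u (t *: v) = t * cross u v.
Proof. by rewrite /cross !coordE; ring. Qed.
Lemma crossC u v : cross u v = - cross v u.
Proof. by rewrite /cross; ring. Qed.
Lemma crossvv u : cross u u = 0.
Proof. by rewrite /cross; ring. Qed.
Lemma cross0r u : cross u 0 = 0.
Proof. by rewrite /cross !mulr0 subrr. Qed.
Lemma cross0l u : cross 0 u = 0.
Proof. by rewrite /cross !mul0r subrr. Qed.

Definition crossE := (crossDl, crossDr, crossNl, crossNr, crossZl, crossZr,
  crossvv).

Definition dotp u v : R := u.1 * v.1 + u.2 * v.2.

Lemma dotp_gt0 u : u != 0 -> 0 < dotp u u.
Proof.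
move=> u0; rewrite lt_def addr_ge0 ?sqr_ge0 -?expr2 ?andbT ?sqr_ge0 //.
apply: contra u0; rewrite /dotp -!expr2 paddr_eq0 ?sqr_ge0 // !sqrf_eq0.
by move=> /andP[/eqP a /eqP b]; apply/eqP/pair_coord.
Qed.

Lemma cross_left_normal u v : cross u (left_normal v) = dotp u v.
Proof. by rewrite /cross /dotp /left_normal /=; ring. Qed.

(* The Lagrange/Plücker identity expressing [cross u w] in the orthogonal frame
   of [l]. *)
Lemma dotp_cross l u w :
  dotp l l * cross u w = dotp l u * cross l w - cross l u * dotp l w.
Proof. by rewrite /dotp /cross; ring. Qed.

Lemma plucker u v w x :
  cross u v * cross w x - cross u w * cross v x + cross u x * cross v w = 0.
Proof. by rewrite /cross; ring. Qed.

(** The linear form [cross l] does not vanish on [u], so it reads off the ratio of parallel vectors.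
    Writing the ratio through [l] ties its sign to orientations against [l]. *)
Lemma parallel_scale l u v : cross l u != 0 -> cross u v = 0 ->
  v = (cross l v / cross l u) *: u.
Proof.
move=> lu uv; apply: pair_coord; rewrite !coordE; apply: (mulfI lu).
  have -> : cross l u * v.1 = cross l v * u.1 - l.1 * cross u v.
    by rewrite /cross; ring.
  by rewrite uv; field.
have -> : cross l u * v.2 = cross l v * u.2 - l.2 * cross u v.
  by rewrite /cross; ring.
by rewrite uv; field.
Qed.

Lemma dotpDr u v w : dotp u (v + w) = dotp u v + dotp u w.
Proof. by rewrite /dotp !coordE; ring. Qed.
Lemma dotpNr u v : dotp u (- v) = - dotp u v.
Proof. by rewrite /dotp !coordE; ring. Qed.
Lemma dotpZr t u v : dotp u (t *: v) = t * dotp u v.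
Proof. by rewrite /dotp !coordE; ring. Qed.

Lemma segment_left p q : segment p q p.
Proof. by exists 0; rewrite /= ?lexx ?ler01 // scale0r addr0. Qed.

Lemma segmentC p q : segment p q = segment q p.
Proof.
suff sub (a b : point) : segment a b `<=` segment b a by apply/seteqP; split; exact: sub.
move=> _ [s /= /andP[s0 s1] <-]; exists (1 - s).
  by rewrite /= subr_ge0 s1 gerBl s0.
by apply: pair_coord; rewrite !coordE; ring.
Qed.

Lemma segment_right p q : segment p q q.
Proof. by rewrite segmentC; exact: segment_left. Qed.

Lemma line_continuous p u : continuous (fun s : R => p + s *: u).
Proof.
move=> s; apply: cvgD; first exact: cvg_cst.
by apply: cvgZr_tmp; exact: cvg_id.
Qed.

Lemma plane_segment_connected p q : connected (segment p q).
Proof.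
have -> : segment p q = (fun s : R => p + s *: (q - p)) @` `[0, 1]%classic.
  by apply/seteqP; split => z [s hs <-]; exists s; rewrite //= ?in_itv in hs *.
apply: connected_continuous_connected; first exact: segment_connected.
exact: continuous_subspaceT (@line_continuous _ _).
Qed.

Lemma plane_segment_compact p q : compact (segment p q).
Proof.
have -> : segment p q = (fun s : R => p + s *: (q - p)) @` `[0, 1]%classic.
  by apply/seteqP; split => z [s hs <-]; exists s; rewrite //= ?in_itv in hs *.
apply: continuous_compact; last exact: segment_compact.
exact: continuous_subspaceT (@line_continuous _ _).
Qed.

Lemma plane_segment_closed p q : closed (segment p q).
Proof. by apply: compact_closed (@plane_segment_compact p q); exact: norm_hausdorff. Qed.

Lemma segment_component (C : set point) p q : segment p q `<=` C ->
  connected_component C p q.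
Proof.
move=> sC; exists (segment p q); last exact: segment_right.
by split => //; [exact: segment_left|exact: plane_segment_connected].
Qed.

Lemma cross_continuous u : continuous (fun z : point => cross u z).
Proof.
move=> z; apply: cvgB; apply: cvgM; try exact: cvg_cst.
  exact: cvg_snd.
exact: cvg_fst.
Qed.

Lemma near_seq (T : eqType) (U : Type) (A : T -> U -> Prop) (F : set_system U)
    (e : seq T) : Filter F ->
  (forall a, a \in e -> \forall z \near F, A a z) ->
  \forall z \near F, forall a, a \in e -> A a z.
Proof.
move=> FF; elim: e => [|a e IH] H; first exact: nearW.
have Ha := H a (mem_head _ _).
have {}IH : \forall z \near F, forall b, b \in e -> A b z.
  by apply: IH => b be; apply: H; rewrite inE be orbT.
apply: filterS2 Ha IH => z Az IH b; rewrite inE => /orP[/eqP -> //|].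
exact: IH.
Qed.

End PlaneVectors.

(** * Left sectors at a vertex of a path *)

Section LeftSector.
Variable R : realType.
Local Notation point := (R * R)%type.
Implicit Types (e f d n u x : point) (s t : R).

(* The directions [d] pointing to the left of a path that goes along [e] and
   then along [f]: a convex cone at a left turn, a union of two half-planes
   otherwise. *)
Definition left_sector e f d : bool :=
  if 0 < cross e f then (0 < cross e d) && (0 < cross f d)
  else (0 < cross e d) || (0 < cross f d).

Lemma left_sectorZ e f t d : 0 < t -> left_sector e f (t *: d) = left_sector e f d.
Proof. by move=> t0; rewrite /left_sector !crossZr !pmulr_rgt0. Qed.

Lemma left_sector_out e f s : 0 <= s -> ~~ left_sector e f (s *: f).
Proof.
move=> s0; rewrite /left_sector !crossZr crossvv mulr0 ltxx andbF orbF.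
by case: ltP => // ef; rewrite -leNgt mulr_ge0_le0.
Qed.

Lemma left_sector_in e f s : 0 <= s -> ~~ left_sector e f (- (s *: e)).
Proof.
move=> s0; rewrite /left_sector !crossNr !crossZr crossvv mulr0 oppr0 ltxx /=.
case: ltP => // ef.
by rewrite (crossC f) mulrN opprK -leNgt mulr_ge0_le0.
Qed.

Lemma near_line (A : point -> Prop) x u : (\forall z \near x, A z) ->
  \forall t \near 0^'+, A (x + t *: u).
Proof.
move=> nA; apply: cvg_within.
apply: (@line_continuous R x u 0).
by rewrite scale0r addr0.
Qed.

Lemma near_line2 (A : point -> Prop) x u n : (\forall z \near x, A z) ->
  \forall d \near 0^'+, \forall t \near 0^'+, A (x + d *: u + t *: n).
Proof.
move=> /nbhs_interior nA.
have := @near_line _ x u nA.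
by apply: filterS => d /near_line; apply.
Qed.

Lemma near0_affine_gt0 (a b : R) : 0 < a -> \forall t \near 0^'+, 0 < a + t * b.
Proof.
move=> a0; apply: cvg_within.
have c : (fun t : R => a + t * b) @ 0 --> (a + 0 * b).
  apply: cvgD; first exact: cvg_cst.
  by apply: cvgM; [exact: cvg_id|exact: cvg_cst].
by apply: (cvgr_gt _ c); rewrite mul0r addr0.
Qed.

(** The order of the two limits matters: at a left turn [d *: f] is strictly to the left of [e], and
    [t] must be small compared with [d] so that [t *: n] does not undo this. Otherwise being to the
    left of [f] suffices. *)
Lemma left_sector_start e f n : 0 < cross f n ->
  \forall d \near 0^'+, \forall t \near 0^'+, left_sector e f (d *: f + t *: n).
Proof.
move=> fn; near=> d.
have d0 : 0 < d by near: d; exact: nbhs_right_gt.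
case: (ltP 0 (cross e f)) => ef.
  have := near0_affine_gt0 (cross e n) (mulr_gt0 d0 ef).
  move=> h; near=> t; rewrite /left_sector ef !crossE mulr0 add0r.
  by rewrite mulr_gt0 // andbT; near: t.
near=> t; rewrite /left_sector ltNge ef /= !crossE mulr0 add0r.
by rewrite (mulr_gt0 _ fn) ?orbT //.
Unshelve. all: by end_near. Qed.

Lemma left_sector_end e f n : 0 < cross e n ->
  \forall d \near 0^'+, \forall t \near 0^'+, left_sector e f (- (d *: e) + t *: n).
Proof.
move=> en; near=> d.
have d0 : 0 < d by near: d; exact: nbhs_right_gt.
case: (ltP 0 (cross e f)) => ef.
  have := near0_affine_gt0 (cross f n) (mulr_gt0 d0 ef).
  move=> h; near=> t; rewrite /left_sector ef !crossE mulr0 oppr0 add0r.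
  rewrite mulr_gt0 //= (crossC f e) mulrN opprK; by near: t.
near=> t; rewrite /left_sector ltNge ef /= !crossE mulr0 oppr0 add0r.
by rewrite mulr_gt0.
Unshelve. all: by end_near. Qed.

(* Two points in the left sector of a right turn, one in each of the two
   half-planes, can both be joined to [e - f]. *)
Lemma left_sector_corner e f : cross e f < 0 ->
  0 < cross e (e - f) /\ 0 < cross f (e - f).
Proof. by move=> ef; rewrite !crossE add0r subr0 (crossC f e) oppr_gt0. Qed.

End LeftSector.

(** * The Jordan curve theorem for polygons *)

Section SimplePolygon.
Variable R : realType.
Local Notation point := (R * R)%type.
Implicit Types (e f d n u x y z w : point) (s t : R) (P : seq point) (l : point).

Definition polygon_curve P : set point :=
  [set z | exists2 x, x \in P & segment x (next P x) z].

(* The vertices of the polygon are listed in [P]; its sides are the segments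
   from [x] to [next P x]. *)
Record simple_polygon l P : Prop := SimplePolygon {
  sp_uniq : uniq P;
  sp_transverse : forall x, x \in P -> cross l (next P x - x) != 0;
  sp_simple : forall x y z, x \in P -> y \in P -> x != y ->
    segment x (next P x) z -> segment y (next P y) z ->
    (z = y /\ next P x = y) \/ (z = x /\ next P y = x) }.

(** Reversal turns the right side into the left one, so results on the left side serve twice. *)
Lemma simple_polygon_rev l P : simple_polygon l P -> simple_polygon l (rev P).
Proof.
case=> uP tP sP; split; first by rewrite rev_uniq.
  move=> x; rewrite mem_rev next_rev // => xP.
  have := tP (prev P x); rewrite mem_prev next_prev // => /(_ xP).
  by apply: contra; rewrite !crossE => /eqP h; apply/eqP; lra.
move=> x y z; rewrite !mem_rev !next_rev // => xP yP xy.
rewrite segmentC -{2}(next_prev uP x) => zx.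
rewrite segmentC -{2}(next_prev uP y) => zy.
have pxy : prev P x != prev P y.
  by apply: contra xy => /eqP h; rewrite -(next_prev uP x) h next_prev.
have := sP _ _ _ _ _ pxy zx zy; rewrite !mem_prev => /(_ xP yP).
by rewrite !next_prev // => -[[-> ->]|[-> ->]]; [right|left].
Qed.

Lemma polygon_curve_rev P : uniq P -> polygon_curve (rev P) = polygon_curve P.
Proof.
move=> uP; apply/seteqP; split=> z [x].
  rewrite mem_rev => xP; rewrite next_rev // segmentC => h.
  by exists (prev P x); rewrite ?mem_prev // next_prev.
move=> xP; rewrite segmentC => h.
by exists (next P x); rewrite ?mem_rev ?mem_next // next_rev // prev_next.
Qed.

Variables (l : point) (P : seq point).
Hypothesis hP : simple_polygon l P.
Let uP := sp_uniq hP.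

Local Notation C := (~` polygon_curve P).
Local Notation out x := (next P x - x).
Local Notation inc x := (x - prev P x).
Local Notation left_at x := (left_sector (inc x) (out x)).

Lemma side_neq0 x : x \in P -> next P x != x.
Proof.
move=> xP; apply: contra (sp_transverse hP xP) => /eqP ->.
by rewrite subrr cross0r.
Qed.

Lemma polygon_near_vertex x : x \in P -> \forall z \near x, forall y, y \in P ->
  y != x -> y != prev P x -> ~ segment y (next P y) z.
Proof.
move=> xP.
apply: (@near_seq _ _ (fun y z => y != x -> y != prev P x ->
  ~ segment y (next P y) z) (nbhs x) P) => y yP.
have [->|yx] := eqVneq y x; first exact: nearW.
have [->|ypx] := eqVneq y (prev P x); first exact: nearW.
have : open_nbhs x (~` segment y (next P y)).
  split; first by apply: closed_openC; exact: plane_segment_closed.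
  move=> xy; have := sp_simple hP xP yP _ (segment_left _ _) xy.
  rewrite eq_sym => /(_ yx)[[xy' _]|[_ nyx]].
    by rewrite xy' eqxx in yx.
  by rewrite -nyx prev_next // eqxx in ypx.
by move=> /open_nbhs_nbhs; apply: filterS => z h _ _.
Qed.

(** Only the two sides at [x] come close to [x], and their points are outside the open sector. *)
Lemma near_left_sector_free x : x \in P ->
  \forall z \near x, left_at x (z - x) -> C z.
Proof.
move=> xP; apply: filterS (polygon_near_vertex xP) => z H Lz [y yP zy].
have [yx|yx] := eqVneq y x.
  move: zy Lz; rewrite yx => -[s /andP[s0 _] <-].
  by rewrite addrAC subrr add0r (negPf (left_sector_out _ _ s0)).
have [yx'|yx'] := eqVneq y (prev P x).
  move: zy Lz; rewrite yx' segmentC next_prev // => -[s /andP[s0 _] <-].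
  by rewrite addrAC subrr add0r -(opprB x (prev P x)) scalerN (negPf (left_sector_in _ _ s0)).
exact: H zy.
Qed.

Lemma near_ball_convex (A : point -> Prop) x : (\forall z \near x, A z) ->
  exists2 r : R, 0 < r & forall z w, `|z - x| < r -> `|w - x| < r ->
    forall v, segment z w v -> A v.
Proof.
move=> /nbhs_normP[r r0 H]; exists r => // z w zr wr v [s /andP[s0 s1] <-].
apply: H; rewrite /= distrC.
have -> : z + s *: (w - z) - x = (1 - s) *: (z - x) + s *: (w - x).
  by apply: pair_coord; rewrite !coordE; ring.
apply: (le_lt_trans (ler_normD _ _)); rewrite !normrZ (ger0_norm s0).
rewrite ger0_norm ?subr_ge0 //.
have [->|sn0] := eqVneq s 0; first by rewrite subr0 mul1r mul0r addr0.
have sp : 0 < s by rewrite lt_def sn0.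
have -> : r = (1 - s) * r + s * r by ring.
by apply: ler_ltD; [rewrite ler_wpM2l ?subr_ge0 // ltW|rewrite ltr_pM2l].
Qed.

Lemma near_norm_lt x (r : R) : 0 < r -> \forall z \near x, `|z - x| < r.
Proof. by move=> r0; apply/nbhs_normP; exists r => // z /=; rewrite distrC. Qed.

Lemma cross_segment_gt0 u x z w v : 0 < cross u (z - x) -> 0 < cross u (w - x) ->
  segment z w v -> 0 < cross u (v - x).
Proof.
move=> zu wu [s /andP[s0 s1] <-].
have -> : z + s *: (w - z) - x = (1 - s) *: (z - x) + s *: (w - x).
  by apply: pair_coord; rewrite !coordE; ring.
rewrite crossDr !crossZr; have [->|sn0] := eqVneq s 0.
  by rewrite subr0 mul1r mul0r addr0.
apply: ltr_wpDl; last by rewrite mulr_gt0 // lt_def sn0.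
by apply: mulr_ge0; [rewrite subr_ge0|exact: ltW].
Qed.

Lemma side_no_backtrack x : x \in P -> cross (inc x) (out x) = 0 ->
  exists2 c : R, 0 < c & out x = c *: inc x.
Proof.
move=> xP par.
have px : prev P x \in P by rewrite mem_prev.
have tin := sp_transverse hP px; rewrite next_prev // in tin.
have outE := parallel_scale tin par.
move: outE; set c := _ / _ => outE.
exists c => //; case: (ltgtP 0 c) => // [neg|zero]; last first.
  move: outE; rewrite -zero scale0r => /eqP.
  by rewrite subr_eq0 (negPf (side_neq0 xP)).
have pxx : prev P x != x.
  by have := side_neq0 px; rewrite next_prev // eq_sym.
(* [s] solves [s = 1 + s * c]: for [c < 0] the point at parameter [s] of the outgoing side is also
   the point at parameter [s] of the incoming one, and it is interior to both. *)
pose s := (1 - c)^-1; have c1 : 0 < 1 - c by lra.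
have s0 : 0 < s by rewrite invr_gt0.
have sc : s * (1 - c) = 1 by rewrite mulVf ?gt_eqF.
have s1 : s < 1 by nra.
pose z := x + s *: out x.
have z1 : segment x (next P x) z by exists s => //=; rewrite !ltW.
have z2 : segment (prev P x) (next P (prev P x)) z.
  rewrite next_prev //; exists (1 + s * c); first by apply/andP; split; nra.
  by rewrite /z outE; apply: pair_coord; rewrite !coordE; ring.
have zE (t : R) : x + t *: out x = x -> t = 0.
  move=> /(canRL (addKr _)); rewrite addNr => /eqP; rewrite scaler_eq0.
  by rewrite subr_eq0 (negPf (side_neq0 xP)) orbF => /eqP.
case: (sp_simple hP px xP pxx z2 z1) => -[zx h]; first by have := zE _ zx; lra.
(* The remaining case is a polygon with two vertices, where [z] would be the far end [next P x]. *)
suff /zE : x + (1 - s) *: out x = x by lra.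
have E : s *: out x = out x.
  by rewrite {2}h -[prev P x in RHS]zx /z [RHS]addrAC subrr add0r.
by rewrite scalerBl scale1r E subrr addr0.
Qed.

End SimplePolygon.

(** * Connectedness of the left side of a polygon *)

Section PolygonStrip.
Variable R : realType.
Local Notation point := (R * R)%type.
Implicit Types (e f d n u x y z w : point) (s t : R).
Variables (l : point) (P : seq point).
Hypothesis hP : simple_polygon l P.
Let uP := sp_uniq hP.

Local Notation C := (~` polygon_curve P).
Local Notation out x := (next P x - x).
Local Notation inc x := (x - prev P x).
Local Notation left_at x := (left_sector (inc x) (out x)).

(** At a left turn the sector is convex. Otherwise it is a union of two half-planes: they coincide
    when the sides are parallel, and at a right turn they are joined through a point [m] in the
    direction [inc x - out x], which belongs to both. *)
Lemma left_sector_component x : x \in P -> exists2 r : R, 0 < r &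
  forall z w, `|z - x| < r -> `|w - x| < r -> left_at x (z - x) ->
    left_at x (w - x) -> connected_component C z w.
Proof.
move=> xP; have [r r0 H] := near_ball_convex (near_left_sector_free hP xP).
exists r => // z w zr wr.
case: (boolP (0 < cross (inc x) (out x))) => [ef|nef].
  rewrite /left_sector ef => /andP[ze zf] /andP[we wf].
  apply: segment_component => v vs; apply: (H _ _ zr wr v vs).
  by rewrite /left_sector ef (cross_segment_gt0 ze we vs) (cross_segment_gt0 zf wf vs).
have half u z' w' : (u == inc x) || (u == out x) -> `|z' - x| < r ->
    `|w' - x| < r -> 0 < cross u (z' - x) -> 0 < cross u (w' - x) ->
    connected_component C z' w'.
  move=> hu zr' wr' zu wu.
  apply: segment_component => v vs; apply: (H _ _ zr' wr' v vs).
  rewrite /left_sector (negPf nef).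
  by case/orP: hu => /eqP <-; rewrite (cross_segment_gt0 zu wu vs) ?orbT.
rewrite /left_sector (negPf nef).
move: nef; rewrite -leNgt le_eqVlt => /orP[/eqP ef|ef].
  have [c c0 oE] := side_no_backtrack hP xP ef.
  have cE v : (0 < cross (inc x) (v - x)) || (0 < cross (out x) (v - x)) ->
      0 < cross (inc x) (v - x).
    by rewrite [cross (out x) _](_ : _ = c * cross (inc x) (v - x)) ?pmulr_rgt0 ?orbb // oE crossZl.
  by move=> /cE ze /cE we; apply: (half (inc x)); rewrite ?eqxx.
have [me mf] := left_sector_corner ef.
have : \forall t \near (0:R)^'+, 0 < t /\ `|x + t *: (inc x - out x) - x| < r.
  near=> t; split; first by near: t; exact: nbhs_right_gt.
  by near: t; exact: near_line (near_norm_lt x r0).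
move=> /filter_ex[t [t0]]; set m := x + _ => mr.
have mE u : cross u (m - x) = t * cross u (inc x - out x).
  by rewrite /m addrAC subrr add0r crossZr.
have {}me : 0 < cross (inc x) (m - x) by rewrite mE mulr_gt0.
have {}mf : 0 < cross (out x) (m - x) by rewrite mE mulr_gt0.
have tom v : `|v - x| < r ->
    (0 < cross (inc x) (v - x)) || (0 < cross (out x) (v - x)) ->
    connected_component C v m.
  move=> vr /orP[]h; first by apply: (half (inc x)); rewrite ?eqxx.
  by apply: (half (out x)); rewrite ?eqxx ?orbT.
move=> hz hw; apply: connected_component_trans (tom _ zr hz) _.
exact: connected_component_sym (tom _ wr hw).
Unshelve. all: by end_near. Qed.

(** The part of the side with parameter in [[d, 1 - d]] is compact and disjoint from the other
    sides, so one bound on [t] works for all [s]; the side itself is avoided because [n] is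
    transverse to it. *)
Lemma strip_free x n (d : R) : x \in P -> cross (out x) n != 0 -> 0 < d ->
  \forall t \near 0^'+, forall s, d <= s <= 1 - d ->
    C (x + s *: out x + t *: n).
Proof.
move=> xP xn d0.
have K := @segment_compact R d (1 - d).
have cov := (compact_near_coveringP _).1 K.
have side y : y \in P -> \forall t \near (0:R)^'+, forall s, d <= s <= 1 - d ->
    ~ segment y (next P y) (x + s *: out x + t *: n).
  move=> yP; have [->|yx] := eqVneq y x.
    near=> t => s _ [s' _].
    move=> /(congr1 (fun z => cross (out x) (z - x))).
    rewrite [X in cross _ X](_ : _ = s' *: out x); last first.
      by rewrite addrAC subrr add0r.
    rewrite [X in _ = cross _ X](_ : _ = s *: out x + t *: n); last first.
      by rewrite addrAC (addrAC x) subrr add0r.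
    rewrite crossDr !crossZr crossvv !mulr0 add0r => /esym/eqP.
    rewrite mulf_eq0 (negPf xn) orbF => /eqP t0.
    suff : 0 < t by rewrite t0 ltxx.
    by near: t; exact: nbhs_right_gt.
  have : \forall t \near (0:R)^'+, `[d, 1 - d] `<=`
      (fun s => ~ segment y (next P y) (x + s *: out x + t *: n)).
    apply: (cov R _ (fun t s => ~ segment y (next P y) (x + s *: out x + t *: n))).
    move=> s; rewrite /= in_itv /= => sI.
    have sC : (~` segment y (next P y)) (x + s *: out x).
      move=> sy; have sx : segment x (next P x) (x + s *: out x).
        exists s => //=; case/andP: sI => h1 h2.
        by rewrite (le_trans (ltW d0) h1) (le_trans h2) // gerBl ltW.
      have zE (r r' : R) : x + r *: out x = x + r' *: out x -> r = r'.
        move=> /addrI/eqP; rewrite -subr_eq0 -scalerBl scaler_eq0.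
        by rewrite !subr_eq0 (negPf (side_neq0 hP xP)) orbF => /eqP.
      rewrite eq_sym in yx.
      case: (sp_simple hP xP yP yx sx sy) => -[E1 E2].
        suff : s = 1 by move: sI => /andP[]; lra.
        by apply: zE; rewrite E1 -E2 scale1r addrC subrK.
      suff : s = 0 by move: sI => /andP[]; lra.
      by apply: zE; rewrite E1 scale0r addr0.
    have : nbhs (x + s *: out x + 0 *: n) (~` segment y (next P y)).
      rewrite scale0r addr0; apply: open_nbhs_nbhs; split => //.
      by apply: closed_openC; exact: plane_segment_closed.
    have cont : (fun st : R * R => x + st.1 *: out x + st.2 *: n) @
        (s, 0) --> x + s *: out x + 0 *: n.
      apply: cvgD; first apply: cvgD; first exact: cvg_cst.
        by apply: cvgZr_tmp; exact: cvg_fst.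
      by apply: cvgZr_tmp; exact: cvg_snd.
    move=> /cont [[A B] [/= nA nB] AB].
    exists (A, (B : set R)); first by split=> //=; exact: cvg_within.
    by move=> [a b] [/= Aa Bb]; exact: (AB (a, b)).
  by apply: filterS => t H s sI; apply: H; rewrite /= in_itv.
have {}side := near_seq _ side.
near=> t => s sI [y yP]; have : forall y, y \in P -> forall s, d <= s <= 1 - d ->
  ~ segment y (next P y) (x + s *: out x + t *: n) by near: t; exact: side.
by move=> /(_ y yP s sI).
Unshelve. all: by end_near. Qed.

End PolygonStrip.

Section PolygonLeftSide.
Variable R : realType.
Local Notation point := (R * R)%type.
Implicit Types (e f n u x y z w : point) (d s t : R).

Section LeftSide.
Variables (l : point) (P : seq point).
Hypothesis hP : simple_polygon l P.
Let uP := sp_uniq hP.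

Local Notation C := (~` polygon_curve P).
Local Notation out x := (next P x - x).
Local Notation inc x := (x - prev P x).
Local Notation left_at x := (left_sector (inc x) (out x)).

(** A strip along the side that joins the sectors at its two ends. [A] and [B] stand for whatever
    closeness to [x] and [next P x] a caller needs; [d <= 2^-1] puts the midpoint of the side in the
    range of the strip. *)
Lemma side_strip (A B : point -> Prop) x n : x \in P -> 0 < cross (out x) n ->
  (\forall z \near x, A z) -> (\forall z \near next P x, B z) ->
  exists2 d : R, 0 < d <= 2^-1 & \forall t \near 0^'+,
    [/\ let z := x + d *: out x + t *: n in left_at x (z - x) /\ A z,
        let z := x + (1 - d) *: out x + t *: n in
          left_at (next P x) (z - next P x) /\ B z &
        forall s s', d <= s <= 1 - d -> d <= s' <= 1 - d ->
          connected_component C (x + s *: out x + t *: n) (x + s' *: out x + t *: n)].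
Proof.
move=> xP xn nA nB.
have hx := left_sector_start (inc x) xn.
have hy := left_sector_end (out (next P x)) xn.
have hA := near_line2 (out x) n nA.
have hB := near_line2 (- out x) n nB.
have : \forall d \near (0:R)^'+, [/\ 0 < d, d <= 2^-1,
  \forall t \near 0^'+, left_sector (inc x) (out x) (d *: out x + t *: n),
  \forall t \near 0^'+, left_sector (out x) (out (next P x)) (- (d *: out x) + t *: n) &
  (\forall t \near 0^'+, A (x + d *: out x + t *: n)) /\
  (\forall t \near 0^'+, B (next P x + d *: - out x + t *: n))].
  near=> d; split; last (split; first by near: d).
  - by near: d; exact: nbhs_right_gt.
  - by near: d; apply: nbhs_right_le; rewrite invr_gt0.
  - by near: d.
  - by near: d.
  - by near: d.
move=> /filter_ex[d [d0 d2 Lx Ly [Ax By]]]; exists d; first by rewrite d0.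
have S := strip_free hP xP (lt0r_neq0 xn) d0.
have yE t : x + (1 - d) *: out x + t *: n = next P x + d *: - out x + t *: n.
  by apply: pair_coord; rewrite !coordE; ring.
near=> t; split=> /=.
- rewrite addrAC (addrAC x) subrr add0r; split; first by near: t.
  by near: t.
- rewrite yE; split; last by near: t.
  by rewrite addrAC (addrAC (next P x)) subrr add0r scalerN prev_next //; near: t.
- move=> s s' /andP[s1 s2] /andP[s3 s4]; apply: segment_component => v [r /andP[r0 r1] <-].
  have -> : x + s *: out x + t *: n + r *: (x + s' *: out x + t *: n - (x + s *: out x + t *: n))
    = x + (s + r * (s' - s)) *: out x + t *: n.
    by apply: pair_coord; rewrite !coordE; ring.
  suff : d <= s + r * (s' - s) <= 1 - d.
    move: (s + _) => s''; move: s''; near: t; exact: S.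
  by apply/andP; split; nra.
Unshelve. all: by end_near. Qed.

(** [w] is a base point that need not be near [x]: it stays fixed while [x] runs around the
    polygon. *)
Definition left_in x w := \forall z \near x,
  left_at x (z - x) -> connected_component C w z.

Lemma left_in_self x : x \in P -> exists w, left_in x w.
Proof.
move=> xP; have xn : 0 < cross (out x) (left_normal (out x)).
  by rewrite cross_left_normal dotp_gt0 // subr_eq0 (side_neq0 hP).
have [r r0 H] := left_sector_component hP xP.
have nB : nbhs (next P x) setT by exact: filterT.
have [d _ nt] := side_strip xP xn (near_norm_lt x r0) nB.
have [t [/= [Lz zr] _ _]] := filter_ex nt.
exists (x + d *: out x + t *: left_normal (out x)).
near=> z => Lz'; apply: H => //; by near: z; exact: near_norm_lt.
Unshelve. all: by end_near. Qed.

Lemma left_in_step x w : x \in P -> left_in x w -> left_in (next P x) w.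
Proof.
move=> xP wx; have xn : 0 < cross (out x) (left_normal (out x)).
  by rewrite cross_left_normal dotp_gt0 // subr_eq0 (side_neq0 hP).
have nxP : next P x \in P by rewrite mem_next.
have [r r0 H] := left_sector_component hP nxP.
have [d /andP[d0 d2] nt] := side_strip xP xn wx (near_norm_lt _ r0).
have [t [/= [Lz wz] [Lz' zr] conn]] := filter_ex nt.
near=> z => Lzz; apply: connected_component_trans (wz Lz) _.
apply: connected_component_trans (conn _ (1 - d) _ _) _; rewrite ?lexx /=; try lra.
by apply: H => //; near: z; exact: near_norm_lt.
Unshelve. all: by end_near. Qed.

Lemma left_in_all x y w : x \in P -> y \in P -> left_in x w -> left_in y w.
Proof.
move=> xP yP wx.
(* After a rotation [P] is the trajectory of [x] under [next P], so [y] is an iterate of [x]. *)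
have [i e rotP] := rot_to xP.
have : fcycle (next P) (x :: e) by rewrite -rotP rot_cycle cycle_next.
rewrite /= => /fpathE eE.
have : y \in x :: rcons e x.
  have : y \in x :: e by rewrite -rotP mem_rot.
  by rewrite !inE mem_rcons inE => /orP[->|->]; rewrite ?orbT.
rewrite eE -[_ :: _]/(traject (next P) x (size (rcons e x)).+1).
move=> /trajectP[m _ ->].
suff : iter m (next P) x \in P /\ left_in (iter m (next P) x) w by case.
elim: m => //= m [mP mw]; rewrite mem_next; split=> //; exact: left_in_step.
Qed.

Lemma left_in_mid x w n : x \in P -> left_in x w -> 0 < cross (out x) n ->
  \forall t \near 0^'+, connected_component C w (x + 2^-1 *: out x + t *: n).
Proof.
move=> xP wx xn.
have nB : nbhs (next P x) setT by exact: filterT.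
have [d /andP[d0 d2] nt] := side_strip xP xn wx nB.
apply: filterS nt => t [/= [Lz wz] _ conn].
by apply: connected_component_trans (wz Lz) (conn _ _ _ _); rewrite ?lexx /=; lra.
Qed.

End LeftSide.
End PolygonLeftSide.

(** * The parity of the number of sides crossed by a ray *)

Section PolygonParity.
Variable R : realType.
Local Notation point := (R * R)%type.
Implicit Types (a b e f n u v x y z w : point) (d s t : R).

Section RayCrossing.
Variable l : point.

(* Does the ray from [z] in direction [l] cross the side [a b]?  The side is
   half-open: its end with the smaller [cross l] coordinate is included. *)
Definition ray_crosses a b z : bool :=
  ((cross l a <= cross l z) (+) (cross l b <= cross l z)) &&
  (0 < cross (b - a) (z - a) * cross l (b - a)).

Lemma near_cross_sign u v (c : R) z : cross u (z - v) * c != 0 ->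
  \forall w \near z, (0 < cross u (w - v) * c) = (0 < cross u (z - v) * c).
Proof.
move=> h0.
have cont : (fun w => cross u (w - v) * c) @ z --> cross u (z - v) * c.
  apply: cvgM; last exact: cvg_cst.
  have -> : (fun w => cross u (w - v)) = (fun w => cross u w - cross u v).
    by apply/funext => w; rewrite crossDr crossNr.
  rewrite crossDr crossNr; apply: cvgB; last exact: cvg_cst.
  exact: cross_continuous.
move: h0; rewrite neq_lt => /orP[h|h].
  apply: filterS (cvgr_lt _ cont _ h) => w hw.
  by rewrite (lt_gtF hw) (lt_gtF h).
apply: filterS (cvgr_gt _ cont _ h) => w hw.
by rewrite hw h.
Qed.

Lemma near_le_cross v z : cross l v != cross l z ->
  \forall w \near z, (cross l v <= cross l w) = (cross l v <= cross l z).
Proof.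
move=> vz.
have E w : (cross l v <= cross l w) = ~~ (0 < cross l (w - v) * -1).
  by rewrite mulrN1 crossDr crossNr oppr_gt0 subr_lt0 -leNgt.
have h : cross l (z - v) * -1 != 0.
  by rewrite mulrN1 oppr_eq0 crossDr crossNr subr_eq0 eq_sym.
by apply: filterS (near_cross_sign h) => w; rewrite !E => ->.
Qed.

(** At the level of [v] the test only compares the positions of [z] and [v] along [l]. The side [u]
    drops out, which is why both sides at a vertex switch together. *)
Lemma ray_crosses_vertex u v z : l != 0 -> cross l u != 0 -> cross l v = cross l z ->
  (0 < cross u (z - v) * cross l u) = (0 < dotp l (v - z)).
Proof.
move=> l0 lu vz; have dl := dotp_gt0 l0.
have := dotp_cross l u (z - v).
rewrite (_ : cross l (z - v) = 0); last by rewrite crossDr crossNr vz subrr.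
rewrite mulr0 sub0r => E; rewrite -(pmulr_rgt0 _ dl) mulrA E.
have -> : - (cross l u * dotp l (z - v)) * cross l u = cross l u ^+ 2 * dotp l (v - z).
  by rewrite -(opprB z) dotpNr; ring.
by rewrite pmulr_rgt0 // exprn_even_gt0.
Qed.

(* As [z] moves past the level of a vertex [v], the two sides at [v] start or
   stop being crossed together; [g v z] records this change. *)
Lemma ray_crosses_near a b z0 : cross l (b - a) != 0 -> ~ segment a b z0 ->
  let g v z := [&& cross l v == cross l z0, 0 < dotp l (v - z0)
                 & cross l v <= cross l z] in
  \forall z \near z0, ray_crosses a b z (+) (g a z (+) g b z) =
                      ray_crosses a b z0 (+) (g a z0 (+) g b z0).
Proof.
move=> D0 nab g.
have l0 : l != 0 by apply: contra D0 => /eqP ->; rewrite cross0l.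
have near_a := @near_le_cross a z0; have near_b := @near_le_cross b z0.
have := D0; rewrite crossDr crossNr subr_eq0 => ab.
(* If [z0] is on the line of the side, it is beyond one of its ends: both ends are strictly on the
   same side of its level, and the side is not crossed from nearby points. *)
have [c0|c0] := eqVneq (cross (b - a) (z0 - a)) 0.
  have := parallel_scale D0 c0; set s := _ / _ => zE.
  have z0E : cross l z0 = cross l a + s * cross l (b - a).
    by rewrite -crossZr -crossDr -zE addrC subrK.
  have ns : (s < 0) || (1 < s).
    rewrite !ltNge -negb_and; apply/negP => s01; apply: nab; exists s => //.
    by rewrite -zE addrC subrK.
  have az : cross l a != cross l z0.
    rewrite z0E -subr_eq0 opprD addNKr oppr_eq0 mulf_neq0 //.
    by case/orP: ns => h; [rewrite lt_eqF|rewrite gt_eqF //; lra].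
  have bz : cross l b != cross l z0.
    rewrite z0E -subr_eq0.
    have -> : cross l b - (cross l a + s * cross l (b - a)) = (1 - s) * cross l (b - a).
      by rewrite !crossDr !crossNr; ring.
    rewrite mulf_neq0 //.
    by case/orP: ns => h; [rewrite gt_eqF|rewrite lt_eqF //]; lra.
  have same : (cross l a <= cross l z0) = (cross l b <= cross l z0).
    rewrite z0E lerDl; have -> : cross l b = cross l a + cross l (b - a).
      by rewrite crossDr crossNr; ring.
    rewrite lerD2l; move: D0; move: (cross l (b - a)) => D.
    rewrite neq_lt => /orP[D0|D0].
      by case/orP: ns => h; apply/idP/idP => h'; nra.
    by case/orP: ns => h; apply/idP/idP => h'; nra.
  near=> z; rewrite /g (negPf az) (negPf bz) /= /ray_crosses.
  have -> : (cross l a <= cross l z) = (cross l a <= cross l z0) by near: z; exact: (near_a az).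
  have -> : (cross l b <= cross l z) = (cross l b <= cross l z0) by near: z; exact: (near_b bz).
  by rewrite same addbb.
have nb : \forall z \near z0, (0 < cross (b - a) (z - a) * cross l (b - a)) =
    (0 < cross (b - a) (z0 - a) * cross l (b - a)).
  by apply: near_cross_sign; rewrite mulf_neq0.
rewrite /g /ray_crosses.
(* At the level of [a], the crossing test changes exactly when the correction [g a] does. *)
have [az|az] := eqVneq (cross l a) (cross l z0).
  have bz : cross l b != cross l z0 by rewrite -az.
  apply: filterS2 nb (near_b bz) => z -> ->.
  rewrite (negPf bz) (ray_crosses_vertex l0 D0 az) /=.
  by case: (_ < _); case: (_ <= _); case: (_ <= _); case: (_ <= _).
have [bz|bz] := eqVneq (cross l b) (cross l z0).
  apply: filterS2 nb (near_a az) => z -> ->.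
  have -> : cross (b - a) (z0 - a) = cross (b - a) (z0 - b).
    by rewrite /cross !coordE; ring.
  rewrite (ray_crosses_vertex l0 D0 bz) /=.
  by case: (_ < _); case: (_ <= _); case: (_ <= _); case: (_ <= _).
by apply: filterS3 nb (near_a az) (near_b bz) => z -> -> ->.
Unshelve. all: by end_near. Qed.

Variable P : seq point.
Hypothesis hP : simple_polygon l P.
Let uP := sp_uniq hP.

Local Notation C := (~` polygon_curve P).
Local Notation out x := (next P x - x).

Definition ray_parity z : bool :=
  \big[addb/false]_(x <- P) ray_crosses x (next P x) z.

(** [next P] permutes the vertices, so each value of [g] is counted twice. *)
Lemma big_addb_next (g : point -> bool) :
  \big[addb/false]_(x <- P) (g x (+) g (next P x)) = false.
Proof.
have permP : perm_eq (map (next P) P) P.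
  apply: uniq_perm => //; first by rewrite map_inj_uniq //; exact: can_inj (prev_next uP).
  move=> x; apply/mapP/idP => [[y yP ->]|xP]; first by rewrite mem_next.
  by exists (prev P x); rewrite ?mem_prev ?next_prev.
rewrite big_split /= -[X in _ (+) X](big_map (next P) xpredT g).
by rewrite (perm_big _ permP) addbb.
Qed.

(** By [big_addb_next] the corrections of [ray_crosses_near] add up to [false], so the parity is
    also the sum of the corrected terms, each of which is locally constant. *)
Lemma ray_parity_near z0 : C z0 ->
  \forall z \near z0, ray_parity z = ray_parity z0.
Proof.
move=> Cz0.
pose g v z := [&& cross l v == cross l z0, 0 < dotp l (v - z0)
                 & cross l v <= cross l z].
pose h x z := ray_crosses x (next P x) z (+) (g x z (+) g (next P x) z).
have hE z : ray_parity z = \big[addb/false]_(x <- P) h x z.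
  by rewrite big_split /= big_addb_next addbF.
have : forall x, x \in P -> \forall z \near z0, h x z = h x z0.
  move=> x xP; apply: ray_crosses_near; first exact: sp_transverse.
  by move=> xz; apply: Cz0; exists x.
move=> /near_seq; apply: filterS => z H; rewrite !hE.
by apply: eq_big_seq => x xP; rewrite H.
Qed.

Lemma ray_parity_component z w : connected_component C z w ->
  ray_parity z = ray_parity w.
Proof.
move=> [A [Az AC Ac] Aw].
have sub (b : bool) : A `&` [set y | ray_parity y = b] =
    A `&` [set y | \forall y' \near y, ray_parity y' = b]°.
  apply/seteqP; split => y [Ay].
    move=> /= yb; split=> //; rewrite -yb.
    by apply: nbhs_interior; exact: ray_parity_near (AC _ Ay).
  by move=> /interior_subset yb; split=> //; exact: nbhs_singleton yb.
have B : A `&` [set y | ray_parity y = ray_parity z] = A.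
  apply: Ac.
  - by exists z.
  - exists ([set y | \forall y' \near y, ray_parity y' = ray_parity z]°).
      exact: open_interior.
    exact: sub.
  - exists (~` [set y | \forall y' \near y, ray_parity y' = ~~ ray_parity z]°).
      by apply: open_closedC; exact: open_interior.
    apply/seteqP; split => y [Ay H]; split => //.
      move=> yn; have [] : (A `&` [set y | ray_parity y = ~~ ray_parity z]) y.
        by rewrite sub.
      by rewrite /= H; case: ray_parity.
    have [//|/eqP yz] := eqVneq (ray_parity y) (ray_parity z).
    have : (A `&` [set y | ray_parity y = ~~ ray_parity z]) y.
      by split=> //=; move: yz; case: ray_parity; case: ray_parity.
    by rewrite sub => -[_ /H].
by have : A w := Aw; rewrite -B => -[_ /= ->].
Qed.

End RayCrossing.
End PolygonParity.

Section PolygonParityFlip.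
Variable R : realType.
Local Notation point := (R * R)%type.
Implicit Types (a b d e f n u v x y z w : point) (c s t : R).

(** The four cases are left, right (the left sector of the reversed path), forward along [f] and
    backward along [e]. The hypothesis on parallel [e] and [f] excludes a fold-back, where the
    continuation of [e] would be in none of them. *)
Lemma sector_cases l e f d : cross l e != 0 -> cross l f != 0 ->
    (cross e f = 0 -> exists2 c : R, 0 < c & f = c *: e) ->
  [\/ left_sector e f d, left_sector (- f) (- e) d,
      exists2 c, 0 <= c & d = c *: f | exists2 c, 0 <= c & d = - (c *: e)].
Proof.
move=> le lf par.
have parf : cross f d = 0 -> cross e f != 0 -> 0 <= cross e d * cross e f ->
    exists2 c, 0 <= c & d = c *: f.
  move=> fd ef; have -> := parallel_scale lf fd; set c := _ / _.
  rewrite crossZr -mulrA pmulr_lge0 => [c0|]; first by exists c.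
  by rewrite -expr2 exprn_even_gt0.
have pare : cross e d = 0 -> cross e f != 0 -> 0 <= cross f d * cross e f ->
    exists2 c, 0 <= c & d = - (c *: e).
  move=> ed ef; have -> := parallel_scale le ed; set c := _ / _.
  rewrite crossZr (_ : _ * _ = - c * cross e f ^+ 2); last first.
    by rewrite (crossC f e); ring.
  rewrite pmulr_lge0 ?exprn_even_gt0 // => c0.
  by exists (- c); rewrite // scaleNr opprK.
rewrite /left_sector !crossNl !crossNr opprK (crossC f e).
case: (ltgtP 0 (cross e f)) => [ef|ef|/esym ef].
- rewrite oppr_gt0 (lt_gtF ef) !oppr_gt0.
  case: (ltP (cross f d) 0) => fd; first by rewrite orTb; constructor 2.
  case: (ltP (cross e d) 0) => ed; first by rewrite orbT; constructor 2.
  move: fd; rewrite le_eqVlt => /orP[/eqP /esym fd|fd].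
    by constructor 3; apply: parf; rewrite ?gt_eqF // mulr_ge0 // ltW.
  move: ed; rewrite le_eqVlt => /orP[/eqP /esym ed|ed].
    by constructor 4; apply: pare; rewrite ?gt_eqF // mulr_ge0 // ltW.
  by constructor 1; rewrite fd ed.
- rewrite oppr_gt0 ef !oppr_gt0.
  case: (ltP 0 (cross f d)) => fd; first by rewrite orbT; constructor 1.
  case: (ltP 0 (cross e d)) => ed; first by rewrite orTb; constructor 1.
  move: fd; rewrite le_eqVlt => /orP[/eqP fd|fd].
    by constructor 3; apply: parf; rewrite ?lt_eqF // mulr_le0 // ltW.
  move: ed; rewrite le_eqVlt => /orP[/eqP ed|ed].
    by constructor 4; apply: pare; rewrite ?lt_eqF // mulr_le0 // ltW.
  by constructor 2; rewrite fd ed.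
- rewrite ef oppr0 ltxx !oppr_gt0.
  have [c c0 fE] := par ef.
  case: (ltgtP (cross e d) 0) => [ed|ed|ed].
  + by constructor 2; rewrite orbT.
  + by constructor 1.
  have dE := parallel_scale le ed; move: dE; set c' := _ / _ => dE.
  case: (leP 0 c') => c'0.
    constructor 3; exists (c' / c); first by rewrite divr_ge0 // ltW.
    by rewrite fE scalerA divfK ?gt_eqF.
  by constructor 4; exists (- c'); rewrite ?oppr_ge0 1?ltW // scaleNr opprK.
Qed.

Section Parity.
Variables (l : point) (P : seq point).
Hypothesis hP : simple_polygon l P.
Let uP := sp_uniq hP.

Local Notation C := (~` polygon_curve P).
Local Notation out x := (next P x - x).
Local Notation inc x := (x - prev P x).

(** Moving along [l] keeps the level, so only the second half of each test can change. The midpoint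
    is on no other side, so the tests of the others agree close to it; the side at [x] is ahead of
    exactly one of the two points. *)
Lemma ray_parity_flip x : x \in P -> \forall t \near 0^'+,
  ray_parity l P (x + 2^-1 *: out x + t *: l) =
  ~~ ray_parity l P (x + 2^-1 *: out x + t *: - l).
Proof.
move=> xP; set m := x + _.
have levelE t : cross l (m + t *: l) = cross l m.
  by rewrite crossDr crossZr crossvv mulr0 addr0.
have levelE' t : cross l (m + t *: - l) = cross l m.
  by rewrite scalerN -scaleNr levelE.
have tx := sp_transverse hP xP.
have same y : y \in P -> \forall t \near (0:R)^'+, y != x ->
    ray_crosses l y (next P y) (m + t *: l) =
    ray_crosses l y (next P y) (m + t *: - l).
  move=> yP; have [->|yx] := eqVneq y x; first exact: nearW.
  rewrite /ray_crosses.
  have [slab|slab] := boolP ((cross l y <= cross l m) (+)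
      (cross l (next P y) <= cross l m)); last first.
    by apply: nearW => t _; rewrite levelE levelE' (negPf slab).
  have ty := sp_transverse hP yP.
  have nb : cross (out y) (m - y) * cross l (out y) != 0.
    rewrite mulf_neq0 //; apply/negP => /eqP par.
    have := parallel_scale ty par; set s := _ / _ => mE.
    have sE : cross l m - cross l y = s * cross l (out y).
      by rewrite -crossNr -crossDr mE crossZr.
    have my : segment y (next P y) m.
      exists s; last by rewrite -mE addrC subrK.
      move: slab; have -> : cross l (next P y) = cross l y + cross l (out y).
        by rewrite crossDr crossNr; ring.
      have -> : cross l m = cross l y + s * cross l (out y) by rewrite -sE; ring.
      move: ty; move: (cross l (out y)) => D D0.
      rewrite lerDl lerD2l; move: D0; rewrite neq_lt => /orP[D0|D0].
        case: (leP 0 (s * D)) => h1; case: (leP D (s * D)) => h2 //= _.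
          exfalso; nra.
        by apply/andP; split; nra.
      case: (leP 0 (s * D)) => h1; case: (leP D (s * D)) => h2 //= _.
        by apply/andP; split; nra.
      exfalso; nra.
    have mx : segment x (next P x) m.
      by exists 2^-1 => //=; apply/andP; split; lra.
    have nx0 : out x != 0 by rewrite subr_eq0 (side_neq0 hP).
    rewrite eq_sym in yx.
    case: (sp_simple hP xP yP yx mx my) => -[E1 E2].
      move: E1; rewrite -E2 /m => /(congr1 (fun v => v - x)).
      rewrite addrAC subrr add0r => /eqP; rewrite -subr_eq0 -{2}[out x]scale1r.
      by rewrite -scalerBl scaler_eq0 (negPf nx0) orbF => /eqP; lra.
    move: E1; rewrite /m => /(congr1 (fun v => v - x)).
    rewrite addrAC subrr add0r => /eqP; rewrite scaler_eq0 (negPf nx0) orbF.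
    by rewrite invr_eq0 pnatr_eq0.
  have h := near_cross_sign nb.
  apply: filterS2 (near_line l h) (near_line (- l) h) => t h1 h2 _.
  by rewrite levelE levelE' h1 h2.
have {}same := near_seq _ same.
near=> t.
have t0 : 0 < t by near: t; exact: nbhs_right_gt.
suff E : ray_parity l P (m + t *: l) (+) ray_parity l P (m + t *: - l) = true.
  by move: E; case: ray_parity; case: ray_parity.
rewrite /ray_parity -big_split /= (bigD1_seq x) //= [X in _ (+) X]big1_seq.
  rewrite addbF /ray_crosses levelE levelE'.
  have belowE s : cross (out x) (m + s *: l - x) * cross l (out x) = - s * cross l (out x) ^+ 2.
    have -> : m + s *: l - x = 2^-1 *: out x + s *: l.
      by rewrite /m addrAC (addrAC x) subrr add0r.
    by rewrite (crossDr (2^-1 *: out x)) !crossZr crossvv (crossC (out x) l); ring.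
  rewrite scalerN -scaleNr !belowE.
  have sq : 0 < cross l (out x) ^+ 2 by rewrite exprn_even_gt0.
  rewrite !(pmulr_lgt0 _ sq) opprK oppr_gt0 t0 (lt_gtF t0) andbF andbT addFb.
  have -> : cross l m = cross l x + 2^-1 * cross l (out x).
    by rewrite /m (crossDr x) crossZr.
  have -> : cross l (next P x) = cross l x + cross l (out x).
    by rewrite crossDr crossNr; ring.
  rewrite lerDl lerD2l; move: tx; move: (cross l (out x)) => D.
  rewrite neq_lt => /orP[D0|D0].
    case: (leP 0 (2^-1 * D)) => h1; case: (leP D (2^-1 * D)) => h2 //=; lra.
  case: (leP 0 (2^-1 * D)) => h1; case: (leP D (2^-1 * D)) => h2 //=; lra.
move=> y /andP[yx yP].
suff -> : ray_crosses l y (next P y) (m + t *: l) =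
    ray_crosses l y (next P y) (m + t *: - l) by rewrite addbb.
by move: y yP yx; near: t; exact: same.
Unshelve. all: by end_near. Qed.

End Parity.
End PolygonParityFlip.

(** * Boundedness of the points of odd parity *)

Section PolygonBounded.
Variable R : realType.
Local Notation point := (R * R)%type.
Implicit Types (a b d e f n u v x y z w : point) (c s t : R).

Section Bounded.
Variables (l : point) (P : seq point).
Hypothesis hP : simple_polygon l P.
Hypothesis P0 : P != [::].
Let uP := sp_uniq hP.

Local Notation C := (~` polygon_curve P).
Local Notation out x := (next P x - x).
Local Notation inc x := (x - prev P x).

Lemma seq_bound (h : point -> R) : exists K, forall x, x \in P -> `|h x| <= K.
Proof.
elim: (P : seq point) => [|a s [K HK]]; first by exists 0.
exists (Num.max `|h a| K) => x; rewrite inE => /orP[/eqP ->|/HK hx].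
  by rewrite le_max lexx.
by rewrite le_max hx orbT.
Qed.

(** [s] is the parameter at which the side meets the level of [z]; the test says that [z] comes
    before that point along [l]. *)
Lemma ray_crosses_level a b z : cross l (b - a) != 0 ->
    (cross l a <= cross l z) (+) (cross l b <= cross l z) ->
  exists s, [/\ 0 <= s <= 1, cross l z = (1 - s) * cross l a + s * cross l b &
    (0 < cross (b - a) (z - a) * cross l (b - a)) =
    (dotp l z < (1 - s) * dotp l a + s * dotp l b)].
Proof.
move=> D0 slab; exists ((cross l z - cross l a) / cross l (b - a)).
set s := _ / _.
have zE : cross l z = cross l a + s * cross l (b - a).
  by rewrite divfK // addrC subrK.
split.
- move: slab D0; have -> : cross l b = cross l a + cross l (b - a).
    by rewrite crossDr crossNr; ring.
  rewrite zE lerDl lerD2l; move: (cross l (b - a)) => D slab.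
  rewrite neq_lt => /orP[D0|D0]; move: slab.
    case: (leP 0 (s * D)) => h1; case: (leP D (s * D)) => h2 //= _.
      by exfalso; nra.
    by apply/andP; split; nra.
  case: (leP 0 (s * D)) => h1; case: (leP D (s * D)) => h2 //= _.
    by apply/andP; split; nra.
  by exfalso; nra.
- by rewrite zE crossDr crossNr; ring.
have l0 : l != 0 by apply: contra D0 => /eqP ->; rewrite cross0l.
have dl := dotp_gt0 l0.
rewrite -(pmulr_rgt0 _ dl) mulrA dotp_cross.
have -> : cross l (z - a) = s * cross l (b - a).
  by rewrite crossDr crossNr zE; ring.
rewrite !dotpDr !dotpNr.
have -> : (((dotp l b - dotp l a) * (s * cross l (b - a)) -
      cross l (b - a) * (dotp l z - dotp l a)) * cross l (b - a)) =
   cross l (b - a) ^+ 2 * ((1 - s) * dotp l a + s * dotp l b - dotp l z) by ring.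
by rewrite pmulr_rgt0 ?exprn_even_gt0 // subr_gt0.
Qed.

Lemma convex_norm_le (K : R) s (p q : R) : 0 <= s <= 1 -> `|p| <= K -> `|q| <= K ->
  `|(1 - s) * p + s * q| <= K.
Proof. by rewrite !ler_norml => /andP[? ?] /andP[? ?] /andP[? ?]; apply/andP; split; nra. Qed.

(** Nothing is crossed from a level that misses the polygon, nor from a point far ahead along [l].
    From a point far back, every side that meets its level is crossed, an even number by
    [big_addb_next]. *)
Lemma ray_parity_bounded : exists M, forall z, ray_parity l P z -> `|z| <= M.
Proof.
have [K1 HK1] := seq_bound (cross l); have [K2 HK2] := seq_bound (dotp l).
have l0 : l != 0.
  case: (P) P0 hP => // a s _ h; have := sp_transverse h (mem_head _ _).
  by apply: contra => /eqP ->; rewrite cross0l.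
have dl := dotp_gt0 l0.
(* The constant comes from recovering the coordinates of [z] from [dotp l z] and [cross l z],
   bounded by [K2] and [K1], as in [coordE1] and [coordE2]. *)
exists ((K1 + K2) * (`|l.1| + `|l.2|) / dotp l l) => z zodd.
have level x : x \in P ->
    (cross l x <= cross l z) (+) (cross l (next P x) <= cross l z) ->
    [/\ `|cross l z| <= K1,
        K2 < dotp l z -> ~~ ray_crosses l x (next P x) z &
        dotp l z < - K2 -> ray_crosses l x (next P x) z].
  move=> xP slab; have nxP : next P x \in P by rewrite mem_next.
  have [s [s01 zE bE]] := ray_crosses_level (sp_transverse hP xP) slab.
  have := convex_norm_le s01 (HK2 _ xP) (HK2 _ nxP).
  rewrite ler_norml => /andP[k1 k2].
  rewrite /ray_crosses slab bE; split.
  - by rewrite zE; apply: convex_norm_le => //; exact: HK1.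
  - by move=> h /=; rewrite -leNgt; lra.
  by move=> h /=; lra.
have crosses_slab x : ray_crosses l x (next P x) z ->
    (cross l x <= cross l z) (+) (cross l (next P x) <= cross l z).
  by case/andP.
have z1 : `|cross l z| <= K1.
  have [//|Kz] := leP `|cross l z| K1; exfalso; move: zodd.
  rewrite /ray_parity big1_seq // => x /= xP; apply/negP => /crosses_slab.
  by move=> /(level _ xP)[]; rewrite leNgt Kz.
have z2 : `|dotp l z| <= K2.
  rewrite ler_norml; apply/andP; split; rewrite leNgt; apply/negP => Kz; move: zodd.
    rewrite /ray_parity (_ : \big[_/_]_(x <- P) _ =
      \big[addb/false]_(x <- P) ((cross l x <= cross l z) (+)
         (cross l (next P x) <= cross l z))).
      by rewrite (big_addb_next hP (fun x => cross l x <= cross l z)).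
    apply: eq_big_seq => x xP; apply/idP/idP; first exact: crosses_slab.
    by move=> /(level _ xP)[_ _]; apply.
  rewrite /ray_parity big1_seq // => x /= xP; apply/negP => xc.
  have [_ /(_ Kz)] := level _ xP (crosses_slab _ xc).
  by rewrite xc.
have coordE1 : dotp l l * z.1 = dotp l z * l.1 - cross l z * l.2.
  by rewrite /dotp /cross; ring.
have coordE2 : dotp l l * z.2 = dotp l z * l.2 + cross l z * l.1.
  by rewrite /dotp /cross; ring.
have K10 : 0 <= K1 by apply: le_trans z1.
have K20 : 0 <= K2 by apply: le_trans z2.
have bound (p q r : R) : dotp l l * r = dotp l z * p + cross l z * q ->
    `|p| + `|q| = `|l.1| + `|l.2| -> `|r| <= (K1 + K2) * (`|l.1| + `|l.2|) / dotp l l.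
  move=> rE pq; rewrite ler_pdivlMr // -(ger0_norm (ltW dl)) -normrM mulrC rE -pq.
  apply: (le_trans (ler_normD _ _)); rewrite !normrM.
  have := normr_ge0 p; have := normr_ge0 q; move: z1 z2.
  by move: `|_ z| `|_ z| `|p| `|q| => A B p' q' *; nra.
rewrite prod_normE ge_max; apply/andP; split.
  by apply: (bound l.1 (- l.2)); rewrite ?normrN // coordE1; ring.
by apply: (bound l.2 l.1); rewrite // addrC.
Qed.

Lemma odd_component_bounded z : ray_parity l P z ->
  bounded_set (connected_component C z).
Proof.
move=> zodd; have [M HM] := ray_parity_bounded.
exists M; split; first exact: num_real.
move=> K MK w /(ray_parity_component hP) zw; apply: le_trans (ltW MK).
by apply: HM; rewrite -zw.
Qed.

End Bounded.
End PolygonBounded.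

(** * The two sides of a polygon *)

Section PolygonJordan.
Variable R : realType.
Local Notation point := (R * R)%type.
Implicit Types (a b d e f n u v x y z w : point) (c s t : R).

Section Jordan.
Variables (l : point) (P : seq point).
Hypothesis hP : simple_polygon l P.
Let uP := sp_uniq hP.

Local Notation C := (~` polygon_curve P).
Local Notation out x := (next P x - x).
Local Notation inc x := (x - prev P x).

Lemma top_vertex : P != [::] -> exists2 x, x \in P & forall y, y \in P -> y.2 <= x.2.
Proof.
elim: (P : seq point) => // a s IH _; case: (eqVneq s [::]) => [->|/IH[x xs hx]].
  by exists a; rewrite ?inE // => y; rewrite inE => /eqP ->.
case: (leP a.2 x.2) => ax.
  exists x; first by rewrite inE xs orbT.
  by move=> y; rewrite inE => /orP[/eqP ->|/hx].
exists a; first by rewrite inE eqxx.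
move=> y; rewrite inE => /orP[/eqP ->//|/hx yx]; exact: le_trans yx (ltW ax).
Qed.

Lemma above_top_unbounded x (h : R) : (forall y, y \in P -> y.2 <= x.2) -> 0 < h ->
  ~ bounded_set (connected_component C (x + h *: (0, 1))).
Proof.
move=> top h0 [M [_ HM]].
have above t : 0 < t -> C (x + t *: (0, 1)).
  move=> t0 [y yP [s /andP[s0 s1]] /(congr1 snd)]; rewrite !coordE /= mulr1.
  by have := top _ yP; have := top (next P y); rewrite mem_next => /(_ yP); nra.
(* This brings the second coordinate of [x + t *: (0, 1)] to at least [|M| + 2], above the bound
   [|M| + 1] obtained from [HM]. *)
pose t := `|x.2| + `|M| + 2.
have t0 : 0 < t by rewrite ltr_wpDl // addr_ge0.
have conn : connected_component C (x + h *: (0, 1)) (x + t *: (0, 1)).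
  apply: segment_component => z [s /andP[s0 s1] <-].
  have -> : x + h *: (0, 1) + s *: (x + t *: (0, 1) - (x + h *: (0, 1))) =
    x + ((1 - s) * h + s * t) *: (0, 1).
    by apply: pair_coord; rewrite !coordE; ring.
  apply: above; have [->|s1'] := eqVneq s 1; first by rewrite subrr mul0r mul1r add0r.
  apply: ltr_pwDl; last by rewrite mulr_ge0 // ltW.
  by rewrite mulr_gt0 // subr_gt0 lt_neqAle s1' s1.
have M1 : M < `|M| + 1 by rewrite (le_lt_trans (ler_norm M)) // ltrDl.
have /= := HM _ M1 _ conn.
rewrite prod_normE ge_max => /andP[_]; rewrite !coordE /= mulr1 => h2.
have := le_trans (ler_norm _) h2.
have : - `|x.2| <= x.2 by rewrite lerNl ler_normr lexx orbT.
rewrite /t; lra.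
Qed.

Lemma left_right_parity wl wr x : x \in P ->
  left_in P x wl -> left_in (rev P) x wr ->
  ray_parity l P wr = ~~ ray_parity l P wl.
Proof.
move=> xP Lw Rw.
have hP' := simple_polygon_rev hP.
have nxP : next P x \in rev P by rewrite mem_rev mem_next.
(* The right of the side at [x] is the left of the same side run backwards, which in [rev P] starts
   at [next P x]. *)
have {}Rw : left_in (rev P) (next P x) wr.
  by apply: (left_in_all hP') Rw => //; rewrite mem_rev.
have tx := sp_transverse hP xP.
have midE : next P x + 2^-1 *: (x - next P x) = x + 2^-1 *: out x.
  by apply: pair_coord; rewrite !coordE; lra.
have side n : 0 < cross (out x) n -> \forall t \near 0^'+,
    ray_parity l P wl = ray_parity l P (x + 2^-1 *: out x + t *: n) /\
    ray_parity l P wr = ray_parity l P (x + 2^-1 *: out x + t *: - n).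
  move=> xn.
  have xn' : 0 < cross (next (rev P) (next P x) - next P x) (- n).
    by rewrite next_rev // prev_next // -(opprB (next P x)) crossNl crossNr opprK.
  have h := left_in_mid hP' nxP Rw xn'.
  move: h; rewrite next_rev // prev_next // midE polygon_curve_rev // => h.
  apply: filterS2 (left_in_mid hP xP Lw xn) h => t h1 h2; split.
    exact: (ray_parity_component hP h1).
  exact: (ray_parity_component hP h2).
have fl := ray_parity_flip hP xP.
case: (ltgtP 0 (cross (out x) l)) => [xl|xl|xl]; last first.
- by move: tx; rewrite crossC -xl oppr0 eqxx.
- have := side (- l); rewrite crossNr oppr_gt0 => /(_ xl) h.
  have [t [[-> ->]]] := filter_ex (filterI h fl).
  by rewrite opprK => ->.
- have [t [[-> ->]]] := filter_ex (filterI (side _ xl) fl).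
  by move=> ->; rewrite negbK.
Qed.

(* The polygonal Jordan curve theorem: [b] tells whether the polygon is
   described with its bounded region on the left. *)
Lemma polygon_sides : exists b : bool, forall x, x \in P ->
  \forall z \near x,
    (left_sector (inc x) (out x) (z - x) ->
       C z /\ (bounded_set (connected_component C z) <-> b)) /\
    (left_sector (- out x) (- inc x) (z - x) ->
       C z /\ (bounded_set (connected_component C z) <-> ~~ b)).
Proof.
have hP' := simple_polygon_rev hP.
have [->|P0] := eqVneq P [::]; first by exists true.
have [x0 x0P top] := top_vertex P0.
have x0P' : x0 \in rev P by rewrite mem_rev.
have [wl Lw] := left_in_self hP x0P.
have [wr Rw] := left_in_self hP' x0P'.
have par := left_right_parity x0P Lw Rw.
have nearL x : x \in P -> \forall z \near x,
    left_sector (inc x) (out x) (z - x) -> C z /\ connected_component C wl z.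
  move=> xP; have h1 := near_left_sector_free hP xP.
  have h2 := left_in_all hP x0P xP Lw.
  by apply: filterS2 h1 h2 => z h1 h2 Lz; split; [exact: h1|exact: h2].
have nearR x : x \in P -> \forall z \near x,
    left_sector (- out x) (- inc x) (z - x) -> C z /\ connected_component C wr z.
  rewrite -mem_rev => xP; have h1 := near_left_sector_free hP' xP.
  have h2 := left_in_all hP' x0P' xP Rw.
  move: h1 h2; rewrite /left_in next_rev // prev_rev // polygon_curve_rev //.
  by rewrite !opprB => h1 h2; apply: filterS2 h1 h2 => z h1 h2 Rz; split; [exact: h1|exact: h2].
have bddE w z : connected_component C w z ->
    bounded_set (connected_component C z) <-> bounded_set (connected_component C w).
  by move=> /same_connected_component ->.
have odd_bdd := odd_component_bounded hP P0.
(* Neither side at the topmost vertex goes up, so the vertical direction is in its left or its right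
   sector. *)
have unb : ~ bounded_set (connected_component C wl) \/
           ~ bounded_set (connected_component C wr).
  have tin := sp_transverse hP (etrans (mem_prev P x0) x0P).
  rewrite next_prev // in tin.
  have := sector_cases (0, 1) tin (sp_transverse hP x0P) (side_no_backtrack hP x0P).
  have pos : \forall t \near (0:R)^'+, 0 < t by exact: nbhs_right_gt.
  case=> [Lu|Ru|[c c0]|[c c0]].
  - left; have [t [t0]] := filter_ex (filterI pos (near_line (0, 1) (nearL _ x0P))).
    rewrite addrAC subrr add0r left_sectorZ //.
    move=> /(_ Lu)[_ /bddE E] /E; exact: above_top_unbounded.
  - right; have [t [t0]] := filter_ex (filterI pos (near_line (0, 1) (nearR _ x0P))).
    rewrite addrAC subrr add0r left_sectorZ //.
    move=> /(_ Ru)[_ /bddE E] /E; exact: above_top_unbounded.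
  - move=> /(congr1 snd); rewrite !coordE /=.
    by have := top (next P x0); rewrite mem_next => /(_ x0P); nra.
  - move=> /(congr1 snd); rewrite !coordE /=.
    by have := top (prev P x0); rewrite mem_prev => /(_ x0P); nra.
(* Odd parity implies bounded, the parities of [wl] and [wr] differ, and one of the two components
   is unbounded. So bounded means odd for both, and [b] is the parity on the left. *)
exists (ray_parity l P wl) => x xP.
have evenP w : (w = wl \/ w = wr) -> bounded_set (connected_component C w) <->
    ray_parity l P w.
  move=> hw; split; last exact: odd_bdd.
  move=> bw; apply/negPn/negP => ew; case: unb => []; apply.
    case: hw => E; rewrite E // in bw ew *.
    by apply: odd_bdd; rewrite -(negbK (ray_parity _ _ _)) -par.
  case: hw => E; rewrite E // in bw ew *.
  by apply: odd_bdd; rewrite par.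
apply: filterS2 (nearL _ xP) (nearR _ xP) => z hL hR; split.
  move=> /hL[Cz cz]; split=> //; apply: iff_trans (bddE _ _ cz) _.
  by apply: evenP; left.
move=> /hR[Cz cz]; split=> //; apply: iff_trans (bddE _ _ cz) _.
by rewrite -par; apply: evenP; right.
Qed.

End Jordan.
End PolygonJordan.

(** * Parity of winding numbers at a vertex *)

Section OrientationSigns.
Variable R : realType.
Local Notation point := (R * R)%type.
Implicit Types (d e f h l : point).

(** What the equation [x + y + z = 0] leaves when only the signs of the three terms are kept. *)
Definition balanced (a b c : int) : bool :=
  [&& a == 0, b == 0 & c == 0] ||
  (has (pred1 1) [:: a; b; c] && has (pred1 (-1)) [:: a; b; c]).

Lemma sgz_balanced (x y z : R) : x + y + z = 0 -> balanced (sgz x) (sgz y) (sgz z).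
Proof.
by case: (sgzP x) => hx; case: (sgzP y) => hy; case: (sgzP z) => hz //= E;
  exfalso; lra.
Qed.

Lemma sgz_mem (x : R) : sgz x \in [:: 1; 0; -1].
Proof. by case: sgzP. Qed.

Lemma gt0_sgzE (x : R) : (0 < x) = (sgz x == 1).
Proof. by case: sgzP. Qed.

Lemma orientC e f : orient f e = - orient e f.
Proof. by rewrite /orient (crossC f) sgzN. Qed.

Lemma orientNl e f : orient (- e) f = - orient e f.
Proof. by rewrite /orient crossNl sgzN. Qed.

Lemma orientNr e f : orient e (- f) = - orient e f.
Proof. by rewrite /orient crossNr sgzN. Qed.

(** The three-term Plücker relation on the level of signs. It ties together all six orientations of
    four vectors and removes sign patterns that no vectors realise. *)
Lemma plucker_signs e f d l : balanced (orient e f * orient d l)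
  (- (orient e d * orient f l)) (orient e l * orient f d).
Proof.
rewrite /orient -!sgzM -sgzN; apply: sgz_balanced.
exact: plucker.
Qed.

Lemma left_sector_signs e f d : left_sector e f d =
  if orient e f == 1 then (orient e d == 1) && (orient f d == 1)
  else (orient e d == 1) || (orient f d == 1).
Proof. by rewrite /left_sector !gt0_sgzE. Qed.

(** [gamma2] for vectors, so that the sign checks do not mention the network. The division is exact
    unless [e] and [l] are parallel. *)
Definition turn_index e l : int := ((1 - orient e l) %/ 2)%Z.

(** If the orientations against [l] agreed, the ratio given by [parallel_scale] would be
    nonnegative. *)
Lemma orient_parallel l f d : orient f l != 0 -> orient f d = 0 ->
    (forall c : R, 0 <= c -> d <> c *: f) ->
  orient f l != orient d l.
Proof.
move=> fl fd nd; have lf : cross l f != 0 by rewrite crossC oppr_eq0 -sgz_eq0.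
move: fd => /eqP; rewrite sgz_eq0 => /eqP fd.
have dE := parallel_scale lf fd; apply/negP => /eqP E.
case: (nd (cross l d / cross l f)) => //.
move: E; rewrite /orient (crossC f) (crossC d) !sgzN => /oppr_inj.
move: lf; rewrite neq_lt => /orP[] lf; [rewrite (ltr0_sgz lf)|rewrite (gtr0_sgz lf)] => /esym E.
  have ld : cross l d < 0 by rewrite -sgz_lt0 E.
  by rewrite ltW // nmulr_lgt0 ?invr_lt0.
have ld : 0 < cross l d by rewrite -sgz_gt0 E.
by rewrite divr_ge0 // ltW.
Qed.

Lemma orient_mem e f : orient e f \in [:: 1; 0; -1].
Proof. exact: sgz_mem. Qed.

(** The check for consecutive cycle edges [e] and [f], over the signs of three orientations. The
    last hypothesis excludes a fold-back. *)
Lemma turn_parity e f l : orient e l != 0 -> orient f l != 0 ->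
    (orient e f = 0 -> orient e l = orient f l) ->
  (2 %| winding e f l + winding (- f) (- e) l + turn_index e l + turn_index f l)%Z.
Proof.
rewrite /winding /turn_index !(orientNl, orientNr) !opprK.
rewrite (orientC e f) (orientC e l) (orientC f l).
have := orient_mem e f; have := orient_mem e l; have := orient_mem f l.
move: (orient e f) (orient e l) (orient f l) => ef el fl.
by rewrite !inE => /or3P[] /eqP -> /or3P[] /eqP -> /or3P[] /eqP -> //= _ _ h;
  have := h erefl.
Qed.

(* Reversing [e] and [f] at a vertex whose third edge [h] comes in. *)
Lemma black_parity e f h l :
    orient e l != 0 -> orient f l != 0 -> orient h l != 0 ->
    (orient e f = 0 -> orient e l = orient f l) ->
    (orient f h = 0 -> orient f l <> - orient h l) ->
    (orient e h = 0 -> orient e l <> orient h l) ->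
  (2 %| winding h f l + winding h (- e) l + winding e f l + turn_index e l +
        ~~ left_sector e f (- h))%Z.
Proof.
have := plucker_signs e f h l.
rewrite /winding /turn_index left_sector_signs !(orientNl, orientNr).
rewrite (orientC e h) (orientC f h) (orientC e l) (orientC f l).
have := orient_mem e f; have := orient_mem e l; have := orient_mem f l.
have := orient_mem e h; have := orient_mem f h; have := orient_mem h l.
move: (orient e f) (orient e l) (orient f l) (orient e h) (orient f h) (orient h l).
move=> ef el fl eh fh hl; rewrite !inE.
move=> /or3P[] /eqP -> /or3P[] /eqP -> /or3P[] /eqP ->.
(* Of the [3^6] sign patterns, computation leaves only those where [f] folds back on [e] or [h]
   overlaps [e] or [f]; each contradicts one of [h1], [h2], [h3]. *)
all: move=> /or3P[] /eqP -> /or3P[] /eqP -> /or3P[] /eqP -> //= _ _ _ _ h1 h2 h3;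
 by [have := h1 erefl|have := h2 erefl|have := h3 erefl].
Qed.

(* Reversing [e] and [f] at a vertex whose third edge [h] goes out. *)
Lemma white_parity e f h l :
    orient e l != 0 -> orient f l != 0 -> orient h l != 0 ->
    (orient e f = 0 -> orient e l = orient f l) ->
    (orient f h = 0 -> orient f l <> orient h l) ->
    (orient e h = 0 -> orient e l <> - orient h l) ->
  (2 %| winding (- f) (- e) l + winding (- f) h l + winding e h l + turn_index e l +
        left_sector e f h)%Z.
Proof.
have := plucker_signs e f h l.
rewrite /winding /turn_index left_sector_signs !(orientNl, orientNr) !opprK.
rewrite (orientC e f) (orientC e l) (orientC h l).
have := orient_mem e f; have := orient_mem e l; have := orient_mem f l.
have := orient_mem e h; have := orient_mem f h; have := orient_mem h l.
move: (orient e f) (orient e l) (orient f l) (orient e h) (orient f h) (orient h l).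
move=> ef el fl eh fh hl; rewrite !inE.
move=> /or3P[] /eqP -> /or3P[] /eqP -> /or3P[] /eqP ->.
all: move=> /or3P[] /eqP -> /or3P[] /eqP -> /or3P[] /eqP -> //= _ _ _ _ h1 h2 h3;
 by [have := h1 erefl|have := h2 erefl|have := h3 erefl].
Qed.

End OrientationSigns.

(** * Edges, cycles and regions of a plabic network *)

Lemma next_map_in (T U : eqType) (h : T -> U) (s : seq T) x :
  uniq (map h s) -> x \in s -> next (map h s) (h x) = h (next s x).
Proof.
case: s => // y s uhs xs.
have us := map_uniq uhs.
have idx : index (h x) (map h (y :: s)) = index x (y :: s).
  by rewrite -{1}(nth_index y xs) -(nth_map y (h y)) ?index_mem // index_uniq // size_map index_mem.
rewrite !next_nth xs map_f // idx.
have := xs; rewrite -index_mem; move: (index x (y :: s)) => i.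
(* At the last index [nth] falls back on its default value, the head: this is how [next] wraps
   around. *)
rewrite /= ltnS leq_eqVlt => /orP[/eqP ->|lt].
  by rewrite nth_default ?size_map // nth_default.
by rewrite (nth_map y).
Qed.

Section Network.
Variables (R : realType) (k n : nat) (N : network R n).
Hypothesis hN : is_plabic_network k N.
Variable l : R * R.
Hypothesis hl : is_gauge_direction N l.
Implicit Types (e f h : edge N) (v : vertex N) (x z : R * R).

Lemma pos_neq e : pos (tgt e) != pos (src e).
Proof.
apply: contra (pn_no_loop hN e) => /eqP /(pn_pos_inj hN) ->; exact: eqxx.
Qed.

Lemma vec_neq0 e : vec e != 0.
Proof. by rewrite /vec subr_eq0 pos_neq. Qed.

Lemma edge_point e (s : R) : 0 <= s <= 1 -> edge_segment e (pos (src e) + s *: vec e).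
Proof. by move=> s01; exists s. Qed.

Lemma edge_point_endpoint e (s : R) v : v \in [:: src e; tgt e] ->
  pos (src e) + s *: vec e = pos v -> s = 0 \/ s = 1.
Proof.
rewrite !inE => /orP[]/eqP -> /(canRL (addKr _)).
  rewrite addNr => /eqP; rewrite scaler_eq0 (negPf (vec_neq0 e)) orbF.
  by move=> /eqP; left.
rewrite addrC -/(vec e) => /eqP; rewrite -subr_eq0 -{2}[vec e]scale1r -scalerBl.
by rewrite scaler_eq0 (negPf (vec_neq0 e)) orbF subr_eq0 => /eqP; right.
Qed.

Lemma boundary_in_out e f j : src e = inl j -> tgt f = inl j -> False.
Proof.
move=> ej fj; have := pn_boundary_degree hN j.
have i0 : (0 < indeg (inl j : vertex N))%N.
  by apply/card_gt0P; exists f; rewrite inE fj.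
have o0 : (0 < outdeg (inl j : vertex N))%N.
  by apply/card_gt0P; exists e; rewrite inE ej.
by rewrite /degree => h; have := leq_add i0 o0; rewrite h.
Qed.

(** Planarity compares two edges. Every vertex has positive degree, so it can be applied to [e] and
    an edge incident to [v]. *)
Lemma edge_meets_vertex e v : edge_segment e (pos v) -> v \in [:: src e; tgt e].
Proof.
move=> ev; have [h hv] : exists h, v \in [:: src h; tgt h].
  have : (0 < degree v)%N.
    case: v ev => [j|u] _; first by rewrite (pn_boundary_degree hN).
    by case: (pn_internal_degree hN u) => ->.
  rewrite /degree addn_gt0 => /orP[] /card_gt0P[h]; rewrite inE => /eqP <-;
  by exists h; rewrite !inE eqxx ?orbT.
have [->//|eh] := eqVneq e h.
have hseg : edge_segment h (pos v).
  move: hv; rewrite !inE => /orP[]/eqP ->; [exact: segment_left|exact: segment_right].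
have [v' [/(pn_pos_inj hN) -> //]] := pn_planar hN eh ev hseg.
Qed.

(* [u] and [u'] are the directions of two distinct edges seen from a common
   endpoint [x]. *)
Lemma edges_not_overlapping e f x u u' (c : R) : e != f ->
    (pos (src e) = x /\ u = vec e) \/ (pos (tgt e) = x /\ u = - vec e) ->
    (pos (src f) = x /\ u' = vec f) \/ (pos (tgt f) = x /\ u' = - vec f) ->
  0 <= c -> u <> c *: u'.
Proof.
move=> ef eu fu c0 uu.
have c1 : 0 < 1 + c by lra.
(* Chosen so that [s + s * c = 1]: the point [x + s *: u] is at distance ratio [s] from [x] on [e]
   and [s * c] on [f], both strictly between 0 and 1. *)
pose s := (1 + c)^-1; have s0 : 0 < s by rewrite invr_gt0.
have sc : s * (1 + c) = 1 by rewrite mulVf ?gt_eqF.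
have cn0 : c != 0.
  apply/eqP => c00; move: uu; rewrite c00 scale0r => u0.
  case: eu => -[_]; rewrite u0 => /eqP; rewrite eq_sym ?oppr_eq0;
  by rewrite (negPf (vec_neq0 e)).
have cp : 0 < c by rewrite lt_def cn0.
have s1 : s < 1 by nra.
have ze : edge_segment e (x + s *: u).
  case: eu => -[<- ->]; first by apply: edge_point; rewrite !ltW.
  rewrite /edge_segment segmentC; exists s; first by rewrite /= !ltW.
  by rewrite /vec opprB.
have zf : edge_segment f (x + s *: u).
  rewrite uu scalerA; have sc1 : 0 <= s * c <= 1 by apply/andP; split; nra.
  case: fu => -[<- ->]; first exact: edge_point.
  rewrite /edge_segment segmentC; exists (s * c) => //.
  by rewrite /vec opprB.
have [v [zv ve _]] := pn_planar hN ef ze zf.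
case: eu => -[xE uE].
  by have := edge_point_endpoint ve (s := s); rewrite xE -uE => /(_ zv)[]; lra.
have := edge_point_endpoint ve (s := 1 - s).
suff -> : pos (src e) + (1 - s) *: vec e = x + s *: u by move=> /(_ zv)[]; lra.
by rewrite -xE uE; apply: pair_coord; rewrite /vec !coordE; ring.
Qed.

(** If the edge were parallel to [l], the vertex [u] would be on the line of the gauge ray of [j]:
    ahead, against [gd_no_vertex], or behind, and then the edge would leave the disk at [j]. *)
Lemma boundary_not_parallel (j : 'I_n) (u : ivertex N) e :
    (src e = inl j /\ tgt e = inr u) \/ (src e = inr u /\ tgt e = inl j) ->
  orient (vec e) l != 0.
Proof.
move=> eu; rewrite /orient sgz_eq0; apply/negP => /eqP par.
pose w := pos (inr u : vertex N) - pos (inl j : vertex N).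
have wE : w = vec e \/ w = - vec e.
  rewrite /w /vec; case: eu => -[-> ->]; [by left|by right; rewrite opprB].
have lw : cross l w = 0.
  by case: wE => ->; rewrite ?crossNr crossC par ?oppr0.
have ll := dotp_gt0 (gd_neq0 hl).
have {}wE : w = (dotp l w / dotp l l) *: l.
  have perp : cross (left_normal l) l != 0.
    by rewrite crossC cross_left_normal oppr_eq0 gt_eqF.
  apply: pair_coord; rewrite !coordE; apply: (mulfI (lt0r_neq0 ll)).
    have -> : dotp l l * w.1 = dotp l w * l.1 - cross l w * l.2.
      by rewrite /dotp /cross; ring.
    by rewrite lw; field; rewrite gt_eqF.
  have -> : dotp l l * w.2 = dotp l w * l.2 + cross l w * l.1.
    by rewrite /dotp /cross; ring.
  by rewrite lw; field; rewrite gt_eqF.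
move: wE; set c := _ / _ => wE.
have uE : pos (inr u : vertex N) = pos (inl j : vertex N) + c *: l.
  by rewrite -wE /w addrC subrK.
have w0 : w != 0.
  rewrite subr_eq0; apply/negP => /eqP /(pn_pos_inj hN) //.
have [c0|c0|c0] := ltgtP 0 c.
- by apply: (gd_no_vertex hl (j := j) (v := u)); exists c.
- have [p [q [t [[pq near_bd] t01 tmon posE]]]] := pn_boundary hN.
  have := near_bd _ (t01 j); rewrite -posE => loc.
  have xy (y : R) : cross (q - p) (pos (inl j : vertex N) + y *: l - p) = y * cross (q - p) l.
    rewrite posE; have -> : p + t j *: (q - p) + y *: l - p = t j *: (q - p) + y *: l.
      by rewrite addrAC (addrAC p) subrr add0r.
    by rewrite (crossDr (t j *: _)) !crossZr crossvv mulr0 add0r.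
  (* The gauge ray enters the disk, so the opposite direction leaves it. *)
  have inside : cross (q - p) l < 0.
    have nin : \forall t \near (0:R)^'+,
      (disk N)° (pos (inl j : vertex N) + t *: l) := gd_inside hl j.
    have nloc := near_line l (nbhs_interior loc).
    have npos : \forall t \near (0:R)^'+, 0 < t by exact: nbhs_right_gt.
    have [s [s0 [sin sloc]]] := filter_ex (filterI npos (filterI nin nloc)).
    have := interior_subset sin => /(nbhs_singleton sloc); rewrite xy.
    rewrite pmulr_rle0 // le_eqVlt => /orP[/eqP par0|//].
    exfalso.
    (* If [l] ran along the boundary line, this interior point of the disk would be on that line,
       and the left normal leaves the half-plane from there. *)
    have sub : nbhs (pos (inl j : vertex N) + s *: l) (fun y => cross (q - p) (y - p) <= 0).
      have hin : \forall y \near pos (inl j : vertex N) + s *: l, disk N y := sin.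
      by apply: filterS2 hin sloc => y dy [+ _]; exact.
    have [r [r0]] := filter_ex (filterI npos (near_line (left_normal (q - p)) sub)).
    have -> : pos (inl j : vertex N) + s *: l + r *: left_normal (q - p) - p =
       (pos (inl j : vertex N) + s *: l - p) + r *: left_normal (q - p).
      by rewrite addrAC.
    rewrite crossDr xy par0 mulr0 add0r crossZr cross_left_normal.
    rewrite pmulr_rle0 // leNgt dotp_gt0 // subr_eq0 eq_sym.
    done.
  have nloc := near_line w loc.
  have npos : \forall t \near (0:R)^'+, 0 < t by exact: nbhs_right_gt.
  have nle1 : \forall t \near (0:R)^'+, t <= 1 by exact: nbhs_right_le.
  have [s [s0 [s1 /= sloc]]] := filter_ex (filterI npos (filterI nle1 nloc)).
  have : disk N (pos (inl j : vertex N) + s *: w).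
    apply: (pn_edge_in_disk hN (e := e)); rewrite /edge_segment.
    case: eu => -[-> ->]; last rewrite segmentC; by exists s => //=; rewrite s1 ltW.
  by move=> /sloc; rewrite wE scalerA xy leNgt nmulr_rgt0 ?inside // pmulr_rlt0.
- by move: w0; rewrite wE -c0 scale0r eqxx.
Qed.

Lemma edge_not_parallel e (u : ivertex N) :
  inr u \in [:: src e; tgt e] -> orient (vec e) l != 0.
Proof.
case es: (src e) => [j|u1]; case et: (tgt e) => [j'|u2].
- by rewrite !inE.
- by move=> _; apply: (boundary_not_parallel (j := j) (u := u2)); left.
- by move=> _; apply: (boundary_not_parallel (j := j') (u := u1)); right.
- by move=> _; exact: (gd_not_parallel hl es et).
Qed.

End Network.

Lemma uniq_map_in_inj (T U : eqType) (h : T -> U) (s : seq T) :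
  uniq (map h s) -> {in s &, injective h}.
Proof.
elim: s => //= a s IH /andP[has /IH inj] x y; rewrite !inE.
case/orP=> [/eqP ->|xs] /orP[/eqP ->|ys] //; last exact: inj.
  by move=> E; rewrite E map_f in has.
by move=> E; rewrite -E map_f in has.
Qed.

(** * The cycle as a simple polygon *)

Section CycleGeometry.
Variables (R : realType) (k n : nat) (N : network R n).
Hypothesis hN : is_plabic_network k N.
Variable l : R * R.
Hypothesis hl : is_gauge_direction N l.
Variable Q : seq (edge N).
Hypothesis hQ : simple_directed_cycle Q.
Implicit Types (e f h : edge N) (v : vertex N) (x z : R * R).

Lemma cycle_src_inj e f : e \in Q -> f \in Q -> src e = src f -> e = f.
Proof. by case: hQ => _ _ uQ eQ fQ; exact: (uniq_map_in_inj uQ eQ fQ). Qed.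

Lemma cycle_next e : e \in Q -> tgt e = src (next Q e).
Proof. by case: hQ => _ cQ _ eQ; apply/eqP; exact: (next_cycle cQ eQ). Qed.

Lemma cycle_prev e : e \in Q -> src e = tgt (prev Q e).
Proof. by case: hQ => _ cQ _ eQ; apply/esym/eqP; exact: (prev_cycle cQ eQ). Qed.

Lemma cycle_uniq : uniq Q.
Proof. by case: hQ => _ _; exact: map_uniq. Qed.

Lemma cycle_tgt_inj e f : e \in Q -> f \in Q -> tgt e = tgt f -> e = f.
Proof.
move=> eQ fQ; rewrite !cycle_next // => /cycle_src_inj.
rewrite !mem_next => /(_ eQ fQ) ef.
by rewrite -(prev_next cycle_uniq e) ef prev_next // cycle_uniq.
Qed.

Lemma cycle_src_internal e : e \in Q -> exists u, src e = inr u.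
Proof.
move=> eQ; case es: (src e) => [j|u]; last by exists u.
have /esym := cycle_prev eQ; rewrite es => et.
by have := boundary_in_out hN es et.
Qed.

Lemma cycle_tgt_internal e : e \in Q -> exists u, tgt e = inr u.
Proof.
by move=> eQ; rewrite cycle_next //; apply: cycle_src_internal; rewrite mem_next.
Qed.

Definition cycle_vertices : seq (R * R) := [seq pos (src e) | e <- Q].

Lemma next_cycle_vertices e : e \in Q ->
  next cycle_vertices (pos (src e)) = pos (tgt e).
Proof.
move=> eQ; rewrite cycle_next //.
apply: (next_map_in (h := fun e => pos (src e))) => //.
rewrite (map_comp (@pos R n N)) map_inj_uniq //; last exact: pn_pos_inj hN.
by case: hQ.
Qed.

(** By planarity two cycle edges share at most vertices. A common source or a common target is
    excluded on a simple cycle, which leaves the two cases of [sp_simple]. *)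
Lemma cycle_vertices_simple : simple_polygon l cycle_vertices.
Proof.
split.
- rewrite /cycle_vertices (map_comp (@pos R n N)) map_inj_uniq //.
    by case: hQ.
  exact: pn_pos_inj hN.
- move=> _ /mapP[e eQ ->]; rewrite next_cycle_vertices //.
  have [u eu] := cycle_src_internal eQ.
  have : orient (vec e) l != 0.
    by apply: (edge_not_parallel hN hl (u := u)); rewrite eu mem_head.
  by rewrite /orient crossC sgzN oppr_eq0 sgz_eq0.
- move=> _ _ z /mapP[e eQ ->] /mapP[f fQ ->] ef; rewrite !next_cycle_vertices // => ze zf.
  have {}ef : e != f by apply: contra ef => /eqP ->.
  have [v [-> ve vf]] := pn_planar hN ef ze zf.
  move: ve vf; rewrite !inE => /orP[]/eqP -> /orP[]/eqP E.
  - by rewrite (cycle_src_inj eQ fQ E) eqxx in ef.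
  - by right; rewrite E.
  - by left; rewrite E.
  - by rewrite (cycle_tgt_inj eQ fQ E) eqxx in ef.
Qed.

Lemma cycle_curveE : cycle_curve Q = polygon_curve cycle_vertices.
Proof.
apply/seteqP; split => z.
  by move=> [e eQ ez]; exists (pos (src e));
    [exact: (map_f (fun e => pos (src e)))|rewrite next_cycle_vertices].
by move=> [_ /mapP[e eQ ->]]; rewrite next_cycle_vertices // => ez; exists e.
Qed.

Lemma cycle_sides : exists b : bool, forall e f, e \in Q -> f \in Q ->
  tgt e = src f -> \forall z \near pos (src f),
    (left_sector (vec e) (vec f) (z - pos (src f)) -> (internal_region Q z <-> b)) /\
    (left_sector (- vec f) (- vec e) (z - pos (src f)) ->
       (internal_region Q z <-> ~~ b)).
Proof.
have [b H] := polygon_sides cycle_vertices_simple.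
exists b => e f eQ fQ ef.
have fP : pos (src f) \in cycle_vertices by apply: (map_f (fun e => pos (src e))).
have := H _ fP; rewrite next_cycle_vertices //.
have -> : prev cycle_vertices (pos (src f)) = pos (src e).
  rewrite -ef -(next_cycle_vertices eQ) prev_next //.
  exact: sp_uniq cycle_vertices_simple.
have -> : pos (src f) - pos (src e) = vec e by rewrite /vec ef.
rewrite -!/(vec _) -cycle_curveE.
apply: filterS => z [hL hR]; split.
  by move=> /hL[Cz bE]; rewrite /internal_region /= -bE; split=> [[]//|].
by move=> /hR[Cz bE]; rewrite /internal_region /= -bE; split=> [[]//|].
Qed.

Lemma curve_vertex v : cycle_curve Q (pos v) -> exists2 f, f \in Q & src f = v.
Proof.
move=> [e eQ /(edge_meets_vertex hN)]; rewrite !inE => /orP[]/eqP ->.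
  by exists e.
by exists (next Q e); rewrite ?mem_next // -cycle_next.
Qed.

Lemma curve_src e : e \in Q -> cycle_curve Q (pos (src e)).
Proof. by move=> eQ; exists e => //; exact: segment_left. Qed.

Lemma curve_tgt e : e \in Q -> cycle_curve Q (pos (tgt e)).
Proof. by move=> eQ; exists e => //; exact: segment_right. Qed.

Lemma internal_component x z : connected_component (~` cycle_curve Q) x z ->
  internal_region Q x <-> internal_region Q z.
Proof.
move=> xz; rewrite /internal_region /= (same_connected_component xz).
have xC := connected_component_sub (connected_component_sym xz).
have zC := connected_component_sub xz.
by split=> -[_ h].
Qed.

Lemma off_cycle h (s : R) : h \notin Q -> 0 < s < 1 ->
  ~ cycle_curve Q (pos (src h) + s *: vec h).
Proof.
move=> hnQ /andP[s0 s1] [e eQ ez].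
have he : h != e by apply: contra hnQ => /eqP ->.
have hz : edge_segment h (pos (src h) + s *: vec h).
  by apply: edge_point; rewrite !ltW.
have [v [zv vh _]] := pn_planar hN he hz ez.
by have := edge_point_endpoint hN vh zv; case; lra.
Qed.

Lemma off_cycle_component h (s s' : R) : h \notin Q ->
    (forall t, 0 <= t <= 1 -> ~ cycle_curve Q (pos (src h) + (s + t * (s' - s)) *: vec h)) ->
  connected_component (~` cycle_curve Q) (pos (src h) + s *: vec h)
    (pos (src h) + s' *: vec h).
Proof.
move=> hnQ H; apply: segment_component => _ [t t01 <-].
suff -> : pos (src h) + s *: vec h + t *: (pos (src h) + s' *: vec h - (pos (src h) + s *: vec h))
  = pos (src h) + (s + t * (s' - s)) *: vec h by exact: H.
by apply: pair_coord; rewrite !coordE; ring.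
Qed.

(** An edge off the cycle can meet it only at its ends, so any interior point tells the region. This
    allows [gamma] to be read at either end. *)
Lemma starts_internal_along h (s : R) : h \notin Q -> 0 < s < 1 ->
  starts_in_internal Q h <-> internal_region Q (pos (src h) + s *: vec h).
Proof.
move=> hnQ /andP[s0 s1]; rewrite /starts_in_internal.
have conn (t : R) : 0 < t < 1 -> connected_component (~` cycle_curve Q)
    (pos (src h) + t *: vec h) (pos (src h) + s *: vec h).
  move=> /andP[t0 t1]; apply: off_cycle_component => // r /andP[r0 r1].
  by apply: off_cycle => //; have [ts|ts] := leP t s; apply/andP; split; nra.
case: asboolP => [_|nc].
  have near01 : \forall t \near (0:R)^'+, 0 < t < 1.
    near=> t; apply/andP; split; near: t; first exact: nbhs_right_gt.
    by apply: nbhs_right_lt.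
  split=> [H|H].
    have [t [t01 ht]] := filter_ex (filterI near01 H).
    exact/(internal_component (conn t t01)).
  by apply: filterS near01 => t t01; apply/(internal_component (conn t t01)).
have -> : pos (src h) = pos (src h) + 0 *: vec h by rewrite scale0r addr0.
rewrite [X in _ <-> internal_region Q (X + _)](_ : _ = pos (src h)); last first.
  by rewrite scale0r addr0.
apply: internal_component; apply: off_cycle_component => // r /andP[r0 r1].
have [->|rn0] := eqVneq r 0; first by rewrite mul0r addr0 scale0r addr0.
apply: off_cycle => //; have r0' : 0 < r by rewrite lt_def rn0.
by apply/andP; split; nra.
Unshelve. all: by end_near. Qed.

Lemma starts_internal_src h : h \notin Q -> ~ cycle_curve Q (pos (src h)) ->
  starts_in_internal Q h <-> internal_region Q (pos (src h)).
Proof. by move=> hnQ nc; rewrite /starts_in_internal; case: asboolP. Qed.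

Lemma starts_internal_tgt h : h \notin Q -> ~ cycle_curve Q (pos (tgt h)) ->
  starts_in_internal Q h <-> internal_region Q (pos (tgt h)).
Proof.
move=> hnQ nc.
have s01 : 0 < (2^-1 : R) < 1 by apply/andP; split; lra.
apply: iff_trans (starts_internal_along hnQ s01) _.
have tE : pos (tgt h) = pos (src h) + 1 *: vec h by rewrite scale1r addrC subrK.
rewrite tE; apply: internal_component; apply: off_cycle_component => // r /andP[r0 r1].
have [->|rn1] := eqVneq r 1.
  have -> : (2^-1 : R) + 1 * (1 - 2^-1) = 1 by lra.
  by rewrite -tE.
apply: off_cycle => //; have r1' : r < 1 by rewrite lt_neqAle rn1.
by apply/andP; split; nra.
Qed.

End CycleGeometry.

(** * The complement of a topological disk *)

Section DiskComplement.
Variable R : realType.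
Local Notation point := (R * R)%type.
Implicit Types (x z w : point) (D : set point).

Local Notation round_disk := [set x : point | x.1 ^+ 2 + x.2 ^+ 2 <= 1].

(** The half-planes beyond the four tangents parallel to the axes are convex and avoid the disk.
    Doubling moves any outside point into one of them, since one of its squared coordinates is at
    least one half; from there [(2, 2)] is reached directly or through a neighbouring corner. *)
Lemma round_disk_exterior_connected z w : ~ round_disk z -> ~ round_disk w ->
  connected_component (~` round_disk) z w.
Proof.
have half (u : point) (a b : point) : (forall y : point, 1 < dotp u y -> ~ round_disk y) ->
    1 < dotp u a -> 1 < dotp u b -> connected_component (~` round_disk) a b.
  move=> H ua ub; apply: segment_component => _ [s /andP[s0 s1] <-]; apply: H.
  rewrite !(dotpDr, dotpZr, dotpNr); case: (leP (dotp u a) (dotp u b)); nra.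
have right (y : point) : 1 < dotp (1, 0) y -> ~ round_disk y.
  by rewrite /dotp /= mul1r mul0r addr0 => h; apply/negP; rewrite -ltNge; nra.
have left (y : point) : 1 < dotp (-1, 0) y -> ~ round_disk y.
  by rewrite /dotp /= mulN1r mul0r addr0 => h; apply/negP; rewrite -ltNge; nra.
have up (y : point) : 1 < dotp (0, 1) y -> ~ round_disk y.
  by rewrite /dotp /= mul1r mul0r add0r => h; apply/negP; rewrite -ltNge; nra.
have down (y : point) : 1 < dotp (0, -1) y -> ~ round_disk y.
  by rewrite /dotp /= mulN1r mul0r add0r => h; apply/negP; rewrite -ltNge; nra.
suff base y : ~ round_disk y -> connected_component (~` round_disk) y (2, 2).
  move=> /base hz /base hw; exact: connected_component_trans hz (connected_component_sym hw).
move=> yout.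
have scale (t : R) : 1 <= t -> connected_component (~` round_disk) y (t *: y).
  move=> t1; apply: segment_component => _ [s /andP[s0 s1] <-].
  move: yout => /negP; rewrite -ltNge => yout; apply/negP; rewrite -ltNge /=.
  have -> : y.1 + s *: (t *: y.1 - y.1) = (1 + s * (t - 1)) * y.1.
    by rewrite -[s *: _]/(s * (t * y.1 - y.1)); ring.
  have -> : y.2 + s *: (t *: y.2 - y.2) = (1 + s * (t - 1)) * y.2.
    by rewrite -[s *: _]/(s * (t * y.2 - y.2)); ring.
  have : 1 <= 1 + s * (t - 1) by nra.
  move: (1 + _) => r r1; rewrite !exprMn -mulrDr.
  have : 1 <= r ^+ 2 by nra.
  by move: (r ^+ 2) (y.1 ^+ 2 + y.2 ^+ 2) yout => r2 y2; nra.
have twice : connected_component (~` round_disk) y (2 *: y) by apply: scale; lra.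
apply: connected_component_trans twice _.
have : 1 < (2 *: y).1 ^+ 2 \/ 1 < (2 *: y).2 ^+ 2.
  have {}yout : 1 < y.1 ^+ 2 + y.2 ^+ 2 by rewrite ltNge; apply/negP.
  case: (leP (y.1 ^+ 2) (2^-1)) => h; [right|left];
  rewrite !coordE exprMn; lra.
have sq (a : R) : 1 < a ^+ 2 -> 1 < a \/ a < -1.
  move=> a2; case: (leP a 1) => h1; [right|by left].
  rewrite ltNge; apply/negP => h2.
  have : 0 <= (1 - a) * (a + 1) by apply: mulr_ge0; lra.
  by move: a2; rewrite expr2; lra.
case=> /sq[] h.
- by apply: (half (1, 0)) => //; rewrite /dotp ?coordE /=; move: h; rewrite ?coordE; lra.
- have corner : connected_component (~` round_disk) (2 *: y) (-2, 2).
    by apply: (half (-1, 0)) => //; rewrite /dotp ?coordE /=; move: h; rewrite ?coordE; lra.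
  apply: connected_component_trans corner _.
  by apply: (half (0, 1)) => //; rewrite /dotp /=; lra.
- by apply: (half (0, 1)) => //; rewrite /dotp ?coordE /=; move: h; rewrite ?coordE; lra.
- have corner : connected_component (~` round_disk) (2 *: y) (2, -2).
    by apply: (half (0, -1)) => //; rewrite /dotp ?coordE /=; move: h; rewrite ?coordE; lra.
  apply: connected_component_trans corner _.
  by apply: (half (1, 0)) => //; rewrite /dotp /=; lra.
Qed.

Lemma round_disk_compact : compact round_disk.
Proof.
apply: (@subclosed_compact _ _ ((`[-1, 1]%classic : set R) `*` (`[-1, 1]%classic : set R))).
- have -> : round_disk = (fun x : point => x.1 ^+ 2 + x.2 ^+ 2) @^-1` [set r | r <= 1] by [].
  apply: closed_comp; last exact: closed_le.
  move=> x _; apply: cvgD; apply: cvgM; by [exact: cvg_fst|exact: cvg_snd].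
- by apply: compact_setX; exact: segment_compact.
by move=> x /= h; split => /=; rewrite in_itv /=; apply/andP; split; nra.
Qed.

Lemma plane_unbounded : ~ bounded_set [set: point].
Proof.
move=> [M [_ HM]]; have M1 : M < `|M| + 1 by rewrite (le_lt_trans (ler_norm M)) // ltrDl.
have /= := HM _ M1 (`|M| + 2, 0) I; rewrite prod_normE ge_max => /andP[/= + _].
rewrite ger0_norm; first by rewrite lerD2l; lra.
by rewrite addr_ge0.
Qed.

Lemma disk_bounded D : is_disk D -> bounded_set D.
Proof.
move=> [h [g [ch _ _ _ ->]]]; apply: compact_bounded.
apply: continuous_compact; last exact: round_disk_compact.
exact: continuous_subspaceT.
Qed.

Lemma disk_exterior_connected D z w : is_disk D -> ~ D z -> ~ D w ->
  connected_component (~` D) z w.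
Proof.
move=> [h [g [ch cg hg gh DE]]] nz nw.
have outD y : ~ D y -> ~ round_disk (g y).
  by move=> nD gy; apply: nD; rewrite DE; exists (g y) => //; rewrite gh.
have [A [Az AC Ac] Aw] := round_disk_exterior_connected (outD _ nz) (outD _ nw).
exists (h @` A); last by exists (g w) => //; rewrite gh.
split; first by exists (g z) => //; rewrite gh.
  move=> _ [y Ay <-]; rewrite DE => -[y' dy' /(can_inj hg) E].
  by apply: (AC _ Ay); rewrite -E.
by apply: connected_continuous_connected => //; exact: continuous_subspaceT.
Qed.

Lemma disk_exterior_unbounded D : is_disk D -> ~ bounded_set (~` D).
Proof.
move=> dD nb; apply: plane_unbounded; rewrite -(setUv D).
have [M1 [_ H1]] := disk_bounded dD; have [M2 [_ H2]] := nb.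
exists (Num.max M1 M2); split; first exact: num_real.
by move=> M; rewrite gt_max => /andP[h1 h2] x [Dx|nDx]; [exact: H1 Dx|exact: H2 nDx].
Qed.

End DiskComplement.

Section BoundaryVertices.
Variables (R : realType) (k n : nat) (N : network R n).
Hypothesis hN : is_plabic_network k N.
Variable l : R * R.
Hypothesis hl : is_gauge_direction N l.
Variable Q : seq (edge N).
Hypothesis hQ : simple_directed_cycle Q.
Implicit Types (e f h : edge N) (v : vertex N) (x z : R * R).

Lemma boundary_off_cycle (j : 'I_n) : ~ cycle_curve Q (pos (inl j : vertex N)).
Proof.
move=> /(curve_vertex hN hQ)[f fQ fj].
by have [u] := cycle_src_internal hN hQ fQ; rewrite fj.
Qed.

Lemma near_off_curve x : ~ cycle_curve Q x -> \forall z \near x, ~ cycle_curve Q z.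
Proof.
move=> nx; have : forall e, e \in Q -> \forall z \near x, ~ edge_segment e z.
  move=> e eQ; have : open_nbhs x (~` edge_segment e).
    split; first by apply: closed_openC; exact: plane_segment_closed.
    by move=> ex; apply: nx; exists e.
  exact: open_nbhs_nbhs.
by move=> /near_seq; apply: filterS => z H [e eQ ez]; exact: H ez.
Qed.

(** A short step along [left_normal (q - p)] leaves the disk without meeting the cycle, and from
    there the whole complement of the disk is reached. *)
Lemma boundary_external (j : 'I_n) : ~ internal_region Q (pos (inl j : vertex N)).
Proof.
set x := pos _ => -[nx bx].
have dD := pn_disk hN.
have [p [q [t [[pq near_bd] t01 _ posE]]]] := pn_boundary hN.
have loc := near_bd _ (t01 j); rewrite -posE -/x in loc.
have [r r0 H] := near_ball_convex (near_off_curve nx).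
have npos : \forall t \near (0:R)^'+, 0 < t by exact: nbhs_right_gt.
have [s [s0 [sloc sr]]] := filter_ex (filterI npos
  (near_line (left_normal (q - p)) (filterI loc (near_norm_lt x r0)))).
set y := x + _ in sloc sr.
have yout : ~ disk N y.
  move=> /sloc; rewrite /y /x posE.
  have -> : p + t j *: (q - p) + s *: left_normal (q - p) - p =
      t j *: (q - p) + s *: left_normal (q - p).
    by rewrite addrAC (addrAC p) subrr add0r.
  rewrite (crossDr (t j *: _)) !crossZr crossvv mulr0 add0r cross_left_normal.
  by rewrite leNgt mulr_gt0 // dotp_gt0 // subr_eq0 eq_sym.
have xy : connected_component (~` cycle_curve Q) x y.
  apply: segment_component => z; apply: (H x y) => //.
  by rewrite subrr normr0.
apply: (disk_exterior_unbounded dD).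
case: bx => M [Mr HM]; exists M; split=> // M' MM' z nz; apply: (HM _ MM').
apply: connected_component_trans xy _.
have [A [Ay AC Ac] Az] := disk_exterior_connected dD yout nz.
exists A => //; split=> // a /AC na [e eQ ea]; apply: na.
exact: (pn_edge_in_disk hN ea).
Qed.

End BoundaryVertices.

(** * The index [gamma] in terms of sectors *)

Section CycleIndex.
Variables (R : realType) (k n : nat) (N : network R n).
Hypothesis hN : is_plabic_network k N.
Variable l : R * R.
Hypothesis hl : is_gauge_direction N l.
Variable Q : seq (edge N).
Hypothesis hQ : simple_directed_cycle Q.
Implicit Types (e f h : edge N) (v : vertex N) (x z : R * R).

(** The property provided by [cycle_sides], for a fixed [b]: true when the cycle runs
    counterclockwise. *)
Definition left_is_internal (b : bool) : Prop := forall e f, e \in Q -> f \in Q ->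
  tgt e = src f -> \forall z \near pos (src f),
    (left_sector (vec e) (vec f) (z - pos (src f)) -> (internal_region Q z <-> b)) /\
    (left_sector (- vec f) (- vec e) (z - pos (src f)) ->
       (internal_region Q z <-> ~~ b)).

Variable b : bool.
Hypothesis hb : left_is_internal b.

(** By [left_sector_end] the points tested by [left_end_in_internal] are in the left sector at the
    end of [e]. *)
Lemma gamma1_cycle e : e \in Q -> gamma1 Q e = b.
Proof.
move=> eQ; have fQ : next Q e \in Q by rewrite mem_next.
have ef := cycle_next hQ eQ.
have en : 0 < cross (vec e) (left_normal (vec e)).
  by rewrite cross_left_normal dotp_gt0 // (vec_neq0 hN).
have hend := left_sector_end (vec (next Q e)) en.
have hnear := near_line2 (- vec e) (left_normal (vec e)) (hb eQ fQ ef).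
have H : \forall d \near 0^'+, \forall t \near 0^'+,
    internal_region Q (pos (tgt e) - d *: vec e + t *: left_normal (vec e)) <-> b.
  apply: filterS2 hend hnear => d h1 h2; apply: filterS2 h1 h2 => t h1 [h2 _].
  rewrite ef -scalerN; apply: h2.
  by rewrite addrAC (addrAC (pos _)) subrr add0r scalerN.
rewrite /gamma1; case: asboolP => [Hl|Hl].
  have [d [h1 h2]] := filter_ex (filterI Hl H).
  have [t [h3 h4]] := filter_ex (filterI h1 h2).
  by rewrite (h4.1 h3).
case: b H Hl => // H Hl; exfalso; apply: Hl.
by apply: filterS H => d; apply: filterS => t [_]; apply.
Qed.

Lemma cycle_orient e : e \in Q -> orient (vec e) l != 0.
Proof.
move=> eQ; have [u eu] := cycle_src_internal hN hQ eQ.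
by apply: (edge_not_parallel hN hl (u := u)); rewrite eu mem_head.
Qed.

Lemma cycle_consecutive_neq e f : tgt e = src f -> e != f.
Proof. by move=> ef; apply/eqP => E; have := pn_no_loop hN e; rewrite ef -E eqxx. Qed.

Lemma cycle_no_backtrack e f : e \in Q -> f \in Q -> tgt e = src f ->
  cross (vec e) (vec f) = 0 -> exists2 c : R, 0 < c & vec f = c *: vec e.
Proof.
move=> eQ fQ ef par.
have le : cross l (vec e) != 0.
  by have := cycle_orient eQ; rewrite /orient crossC sgzN oppr_eq0 sgz_eq0.
have := parallel_scale le par; set c := _ / _ => fE; exists c => //.
rewrite ltNge; apply/negP => c0.
have ne : f != e by rewrite eq_sym cycle_consecutive_neq.
have := edges_not_overlapping hN (x := pos (src f)) (u := vec f) (u' := - vec e) (c := - c) ne.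
move=> H; apply: H.
- by left.
- by right; rewrite ef.
- by rewrite oppr_ge0.
- by rewrite scalerN scaleNr opprK.
Qed.

Lemma cycle_parallel e f : e \in Q -> f \in Q -> tgt e = src f ->
  orient (vec e) (vec f) = 0 -> orient (vec e) l = orient (vec f) l.
Proof.
move=> eQ fQ ef /eqP; rewrite sgz_eq0 => /eqP /(cycle_no_backtrack eQ fQ ef)[c c0 ->].
by rewrite /orient crossZl sgzM (gtr0_sgz c0) mul1r.
Qed.

Lemma near_sector_internal e f (d : R * R) : e \in Q -> f \in Q -> tgt e = src f ->
    (forall c, 0 <= c -> d <> c *: vec f) ->
    (forall c, 0 <= c -> d <> c *: - vec e) ->
  \forall t \near 0^'+, internal_region Q (pos (src f) + t *: d) <->
                        (left_sector (vec e) (vec f) d == b).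
Proof.
move=> eQ fQ ef df de.
have lc g : g \in Q -> cross l (vec g) != 0.
  by move=> /cycle_orient; rewrite /orient crossC sgzN oppr_eq0 sgz_eq0.
have npos : \forall t \near (0:R)^'+, 0 < t by exact: nbhs_right_gt.
have near_side := near_line d (hb eQ fQ ef).
apply: filterS2 npos near_side => t t0.
rewrite [_ + t *: d - _]addrAC subrr add0r !left_sectorZ // => -[hL hR].
have [Ld|Ld] := boolP (left_sector (vec e) (vec f) d); first by rewrite eq_sym eqb_id; exact: hL.
have Rd : left_sector (- vec f) (- vec e) d.
  case: (sector_cases d (lc _ eQ) (lc _ fQ) (cycle_no_backtrack eQ fQ ef)) => //.
  - by rewrite (negPf Ld).
  - by move=> [c c0 dE]; case: (df c).
  - by move=> [c c0 dE]; case: (de c) => //; rewrite scalerN.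
by rewrite eq_sym eqbF_neg; exact: hR.
Qed.

Lemma gamma_out e f h : e \in Q -> f \in Q -> tgt e = src f -> h \notin Q ->
  src h = src f -> gamma l Q h = (left_sector (vec e) (vec f) (vec h) == b).
Proof.
move=> eQ fQ ef hnQ hf; rewrite /gamma (negPf hnQ).
have hne g : g \in Q -> h != g by move=> gQ; apply: contra hnQ => /eqP ->.
have H : \forall t \near 0^'+, internal_region Q (pos (src h) + t *: vec h) <->
    (left_sector (vec e) (vec f) (vec h) == b).
  rewrite hf; apply: near_sector_internal => // c c0.
    by apply: (edges_not_overlapping hN (hne _ fQ) (x := pos (src f))); rewrite ?hf //; left.
  by apply: (edges_not_overlapping hN (hne _ eQ) (x := pos (src f)));
    rewrite ?ef ?hf //; [left|right].
rewrite /starts_in_internal; case: (asboolP (cycle_curve _ _)) => [_|nc]; last first.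
  by case: nc; rewrite hf; exact: curve_src.
case: asboolP => [Hl|Hl].
  by have [t [h3 tE]] := filter_ex (filterI Hl H); rewrite (tE.1 h3).
case: (_ == b) H Hl => // H Hl; exfalso; apply: Hl.
by apply: filterS H => t [_]; apply.
Qed.

(** [gamma] is defined at the start of [h], while the relation at the vertex sees the end of [h], in
    the direction [- vec h]; [starts_internal_along] carries the region from one to the other. *)
Lemma gamma_in e f h : e \in Q -> f \in Q -> tgt e = src f -> h \notin Q ->
  tgt h = src f -> gamma l Q h = (left_sector (vec e) (vec f) (- vec h) == b).
Proof.
move=> eQ fQ ef hnQ hf; rewrite /gamma (negPf hnQ).
have hne g : g \in Q -> h != g by move=> gQ; apply: contra hnQ => /eqP ->.
have H : \forall t \near 0^'+, internal_region Q (pos (src f) + t *: - vec h) <->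
    (left_sector (vec e) (vec f) (- vec h) == b).
  apply: near_sector_internal => // c c0.
    by apply: (edges_not_overlapping hN (hne _ fQ) (x := pos (src f)));
      rewrite ?hf //; [right|left].
  by apply: (edges_not_overlapping hN (hne _ eQ) (x := pos (src f)));
    rewrite ?ef ?hf //; right.
have near01 : \forall t \near (0:R)^'+, 0 < 1 - t < 1.
  near=> t; apply/andP; split; last by rewrite gtrBl; near: t; exact: nbhs_right_gt.
  by rewrite subr_gt0; near: t; exact: nbhs_right_lt.
have [t [t01 tE]] := filter_ex (filterI near01 H).
have := starts_internal_along hN hnQ t01.
have -> : pos (src h) + (1 - t) *: vec h = pos (src f) + t *: - vec h.
  by rewrite -hf; apply: pair_coord; rewrite /vec !coordE; ring.
move=> sE; have {}sE := iff_trans sE tE.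
by case: asboolP => [/sE -> //|]; case: (_ == b) sE => // -[_ h1] h2; case: h2; apply: h1.
Unshelve. all: by end_near. Qed.

Lemma gamma_off_src h : h \notin Q -> ~ cycle_curve Q (pos (src h)) ->
  gamma l Q h = `[< internal_region Q (pos (src h)) >].
Proof.
move=> hnQ nc; rewrite /gamma (negPf hnQ).
have E := starts_internal_src hnQ nc.
by do 2 case: asboolP => //; move=> *; exfalso; tauto.
Qed.

Lemma gamma_off_tgt h : h \notin Q -> ~ cycle_curve Q (pos (tgt h)) ->
  gamma l Q h = `[< internal_region Q (pos (tgt h)) >].
Proof.
move=> hnQ nc; rewrite /gamma (negPf hnQ).
have E := starts_internal_tgt hN hnQ nc.
by do 2 case: asboolP => //; move=> *; exfalso; tauto.
Qed.

End CycleIndex.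

(** * Reversing the cycle *)

Section SignPowers.
Variable R : realType.

Lemma signrz_even (z : int) : (2 %| z)%Z -> (-1 : R) ^ z = 1.
Proof.
move=> /dvdzP[q ->]; rewrite mulrC -exprz_exp.
by rewrite -exprnP sqrrN expr1n exp1rz.
Qed.

Lemma signrzD (y z : int) : (-1 : R) ^ (y + z) = (-1) ^ y * (-1) ^ z.
Proof. by rewrite expfzDr // oppr_eq0 oner_eq0. Qed.

Lemma signrz_sq (z : int) : (-1 : R) ^ z * (-1) ^ z = 1.
Proof.
by rewrite -signrzD signrz_even // (_ : z + z = z * 2) ?dvdz_mull //; ring.
Qed.

Lemma signrz_neq0 (z : int) : (-1 : R) ^ z != 0.
Proof. by rewrite expfz_neq0 // oppr_eq0 oner_eq0. Qed.

Lemma signrz_eq (y z : int) : (2 %| y + z)%Z -> (-1 : R) ^ y = (-1) ^ z.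
Proof.
move=> /signrz_even; rewrite signrzD => E.
by apply: (mulIf (signrz_neq0 z)); rewrite E signrz_sq.
Qed.

Lemma dvd2_addl (q z : int) : (2 %| q * 2 + z)%Z = (2 %| z)%Z.
Proof.
apply/dvdzP/dvdzP => -[c E]; [exists (c - q)|exists (c + q)].
  by rewrite mulrBl -E; ring.
by rewrite E; ring.
Qed.

(** Naming [q], half of the difference, turns a congruence modulo 2 into an identity for [ring]. *)
Lemma dvd2_congr (q y z : int) : y = q * 2 + z -> (2 %| z)%Z -> (2 %| y)%Z.
Proof. by move=> ->; rewrite dvd2_addl. Qed.

(** With [c] a sector test, this removes the bit [b] from the parity: no local check depends on
    which side of the cycle is internal. *)
Lemma dvd2_bool_eq (c b : bool) (z : int) :
  (2 %| z + (b : nat)%:Z + ((c == b) : nat)%:Z)%Z = (2 %| z + (~~ c : nat)%:Z)%Z.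
Proof.
case: c; case: b => //=; rewrite ?addr0 //.
by rewrite (_ : _ + 1 = 1 * 2 + z) ?dvd2_addl //; ring.
Qed.

End SignPowers.

(** * Signs of the coefficients after reversal *)

Section ReversedCoefficients.
Variables (R : realType) (k n : nat) (N : network R n).
Hypothesis hN : is_plabic_network k N.
Variable l : R * R.
Hypothesis hl : is_gauge_direction N l.
Variable Q : seq (edge N).
Hypothesis hQ : simple_directed_cycle Q.
Implicit Types (e f h : edge N) (v : vertex N).

Local Notation N' := (reverse_cycle Q).
Local Notation coef := (@edge_coef R n N l).
Local Notation coef' := (@edge_coef R n N' l).

Lemma vec_reverse e : @vec R n N' e = if e \in Q then - vec e else vec e.
Proof. by rewrite /vec /=; case: ifP => // _; rewrite opprB. Qed.

Lemma pivots_reverse : pivots N' = pivots N.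
Proof.
apply/setP => j; rewrite !inE; apply/existsP/existsP => -[e /=].
  case: ifP => [eQ /eqP E|_ E]; last by exists e.
  by have [u] := cycle_tgt_internal hN hQ eQ; rewrite E.
move=> /eqP E; exists e => /=; case: ifP => [eQ|_]; last by rewrite E.
by have [u] := cycle_src_internal hN hQ eQ; rewrite E.
Qed.

Lemma nb_int_reverse e : @nb_int R n N' l e = nb_int l e.
Proof.
rewrite /nb_int pivots_reverse; apply: eq_card => j; rewrite !inE.
congr (_ && `[< _ `&` _ !=set0 >]).
by rewrite /edge_segment /=; case: ifP => // _; exact: segmentC.
Qed.

Variable b : bool.
Hypothesis hb : left_is_internal Q b.

(* The common factor [alpha] by which the relation at a vertex of the cycle is
   multiplied when [e] and [f] are reversed. *)
Definition alpha e f : R := coef' f e * ((-1) ^ gamma l Q e / weight e).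

Lemma weight_neq0 e : weight e != 0.
Proof. by rewrite gt_eqF // (pn_weight hN). Qed.

Lemma alpha_coef e f : e \in Q -> f \in Q -> tgt e = src f ->
  alpha e f * coef e f = (-1) ^ gamma l Q f / weight f.
Proof.
move=> eQ fQ ef; rewrite /alpha /edge_coef /wind !vec_reverse nb_int_reverse /= eQ fQ.
have we := weight_neq0 e; have wf := weight_neq0 f.
rewrite [LHS](_ : _ = ((-1) ^ ((nb_int l f)%:Z + winding (- vec f) (- vec e) l) *
  (-1) ^ gamma l Q e * (-1) ^ ((nb_int l e)%:Z + winding (vec e) (vec f) l)) / weight f);
  last by field; rewrite we wf.
congr (_ / _); rewrite -!signrzD; apply: signrz_eq.
rewrite /gamma eQ fQ !(gamma1_cycle hN hQ hb) //.
have := turn_parity (cycle_orient hN hl hQ eQ) (cycle_orient hN hl hQ fQ)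
  (cycle_parallel hN hl hQ eQ fQ ef).
rewrite -[turn_index (vec e) l]/(gamma2 l e) -[turn_index (vec f) l]/(gamma2 l f).
move: (winding _ _ _) (winding _ _ _) (gamma2 l e) (gamma2 l f) => w1 w2 g1 g2.
move: (nb_int l e)%:Z (nb_int l f)%:Z (b : nat)%:Z => i1 i2 c H.
(* Each intersection number and the common value of [gamma1] occur twice in the exponent. *)
by apply: (@dvd2_congr (i2 + i1 + c) _ _ _ H); ring.
Qed.

Lemma third_edge_signs e f h (d : R * R) : e \in Q -> f \in Q -> tgt e = src f ->
    h != e -> h != f ->
    (src h = src f /\ d = vec h) \/ (tgt h = src f /\ d = - vec h) ->
  [/\ orient (vec h) l != 0,
      orient (vec f) d = 0 -> orient (vec f) l <> orient d l &
      orient (vec e) d = 0 -> orient (vec e) l <> - orient d l].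
Proof.
move=> eQ fQ ef he hf hd; split.
- have [u fu] := cycle_src_internal hN hQ fQ.
  apply: (edge_not_parallel hN hl (u := u)); rewrite !inE -fu.
  by case: hd => -[-> _]; rewrite eqxx ?orbT.
- move=> fd; apply/eqP/(orient_parallel (cycle_orient hN hl hQ fQ) fd) => c c0.
  apply: (edges_not_overlapping hN hf (x := pos (src f))); rewrite //; last by left.
  by case: hd => -[-> ->]; [left|right].
- move=> ed; have eN : orient (- vec e) l != 0.
    by rewrite orientNl oppr_eq0 (cycle_orient hN hl hQ).
  have ed' : orient (- vec e) d = 0 by rewrite orientNl ed oppr0.
  have : orient (- vec e) l != orient d l.
    apply: (orient_parallel eN ed') => c c0.
    apply: (edges_not_overlapping hN he (x := pos (src f))); rewrite //.
      by case: hd => -[-> ->]; [left|right].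
    by right; rewrite ef.
  by rewrite orientNl => /eqP H E; apply: H; rewrite E opprK.
Qed.

Lemma alpha_in e f h : e \in Q -> f \in Q -> tgt e = src f ->
    h \notin Q -> tgt h = src f ->
  coef' h e * ((-1) ^ gamma l Q e / weight e) * coef e f =
  (-1) ^ gamma l Q h * coef h f.
Proof.
move=> eQ fQ ef hnQ hf.
have hne g : g \in Q -> h != g by move=> gQ; apply: contra hnQ => /eqP ->.
have [hl0 s1 s2] := third_edge_signs eQ fQ ef (hne _ eQ) (hne _ fQ) (or_intror (conj hf erefl)).
rewrite /edge_coef /wind !vec_reverse nb_int_reverse /= eQ (negPf hnQ).
have we := weight_neq0 e.
rewrite [LHS](_ : _ = ((-1) ^ ((nb_int l h)%:Z + winding (vec h) (- vec e) l) *
  (-1) ^ gamma l Q e * (-1) ^ ((nb_int l e)%:Z + winding (vec e) (vec f) l)) * weight h);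
  last by field.
rewrite mulrA; congr (_ * _); rewrite -!signrzD; apply: signrz_eq.
rewrite (gamma_in hN hl hQ hb eQ fQ ef hnQ hf) /gamma eQ (gamma1_cycle hN hQ hb) //.
have {}s1 : orient (vec f) (vec h) = 0 -> orient (vec f) l <> - orient (vec h) l.
  by move=> E; move: s1; rewrite orientNr E oppr0 orientNl; apply.
have {}s2 : orient (vec e) (vec h) = 0 -> orient (vec e) l <> orient (vec h) l.
  by move=> E; move: s2; rewrite orientNr E oppr0 orientNl opprK; apply.
have := black_parity (cycle_orient hN hl hQ eQ) (cycle_orient hN hl hQ fQ) hl0
  (cycle_parallel hN hl hQ eQ fQ ef) s1 s2.
rewrite -(dvd2_bool_eq _ b) -[turn_index (vec e) l]/(gamma2 l e).
move: (winding _ _ _) (winding _ _ _) (winding _ _ _) (gamma2 l e) => w1 w2 w3 g1.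
move: (nb_int l e)%:Z (nb_int l h)%:Z (b : nat)%:Z (_ : nat)%:Z => i1 i2 c r H.
by apply: (@dvd2_congr (i2 + i1) _ _ _ H); ring.
Qed.

(** The minus sign comes from solving the relation of [e] for the term of [f], which moves the term
    of [h] across the equation. *)
Lemma alpha_out e f h : e \in Q -> f \in Q -> tgt e = src f ->
    h \notin Q -> src h = src f ->
  coef' f h * (-1) ^ gamma l Q h = - (alpha e f * coef e h).
Proof.
move=> eQ fQ ef hnQ hf.
have hne g : g \in Q -> h != g by move=> gQ; apply: contra hnQ => /eqP ->.
have [hl0 s1 s2] := third_edge_signs eQ fQ ef (hne _ eQ) (hne _ fQ) (or_introl (conj hf erefl)).
rewrite /alpha /edge_coef /wind !vec_reverse nb_int_reverse /= eQ fQ (negPf hnQ).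
have we := weight_neq0 e; have wf := weight_neq0 f.
rewrite [RHS](_ : _ = ((-1) ^ (1 : int) * (-1) ^ ((nb_int l f)%:Z + winding (- vec f) (- vec e) l) *
  (-1) ^ gamma l Q e * (-1) ^ ((nb_int l e)%:Z + winding (vec e) (vec h) l)) / weight f);
  last by rewrite expr1z; field; rewrite we wf.
rewrite mulrAC; congr (_ / _); rewrite -!signrzD; apply: signrz_eq.
rewrite (gamma_out hN hl hQ hb eQ fQ ef hnQ hf) /gamma eQ (gamma1_cycle hN hQ hb) //.
have := white_parity (cycle_orient hN hl hQ eQ) (cycle_orient hN hl hQ fQ) hl0
  (cycle_parallel hN hl hQ eQ fQ ef) s1 s2.
move=> H0.
(* Modulo 2 the sector test is 1 plus its negation; the 1 matches the exponent of the minus sign,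
   and the negation is the form that [dvd2_bool_eq] produces. *)
have {H0} : (2 %| winding (- vec f) (- vec e) l + winding (- vec f) (vec h) l +
    winding (vec e) (vec h) l + turn_index (vec e) l + 1 +
    (~~ left_sector (vec e) (vec f) (vec h) : nat)%:Z)%Z.
  apply: (@dvd2_congr (~~ left_sector (vec e) (vec f) (vec h) : nat)%:Z _ _ _ H0).
  by case: left_sector => /=; ring.
rewrite -(dvd2_bool_eq _ b) -[turn_index (vec e) l]/(gamma2 l e).
move: (winding _ _ _) (winding _ _ _) (winding _ _ _) (gamma2 l e) => w1 w2 w3 g1.
move: (nb_int l e)%:Z (nb_int l f)%:Z (b : nat)%:Z (_ : nat)%:Z => i1 i2 c r H.
by apply: (@dvd2_congr (i2 + i1) _ _ _ H); ring.
Qed.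

End ReversedCoefficients.

Lemma card2_pred2 (T : finType) (A : pred T) : #|A| = 2%N ->
  exists x y, x != y /\ A =i pred2 x y.
Proof.
move=> A2; have /card_gt0P[x xA] : (0 < #|A|)%N by rewrite A2.
have := cardD1 x A; rewrite A2 xA add1n => -[/esym/mem_card1[y yE]].
exists x, y; have := yE y; rewrite !inE eqxx => /andP[yx yA].
split; first by rewrite eq_sym.
move=> z; have := yE z; rewrite !inE.
by have [->|zx] := eqVneq z x; rewrite /= ?xA.
Qed.

(** * A uniform relation at internal vertices *)

Section VertexRelation.
Variables (R : realType) (n : nat) (l : R * R).

(** One sum covers bivalent, black and trivalent white vertices, so that a reversal becomes a
    reindexing. *)
Definition vertex_relation (N : network R n) (E : edge N -> 'rV[R]_n)
    (u : ivertex N) : Prop := forall e : edge N, tgt e = inr u ->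
  E e = \sum_(f | src f == inr u) edge_coef l e f *: E f.

Definition sink_relations (N : network R n) (B : 'I_n -> 'rV[R]_n)
    (E : edge N -> 'rV[R]_n) : Prop := forall (e : edge N) (j : 'I_n),
  tgt e = inl j -> E e = ((-1) ^+ nb_int l e * weight e) *: B j.

(** Only degrees and colours are assumed, as these are the properties checked for the reversed
    network. *)
Lemma edge_relationsE (N : network R n) (B : 'I_n -> 'rV[R]_n)
    (E : edge N -> 'rV[R]_n) :
    (forall u : ivertex N, degree (inr u : vertex N) = 2%N \/
       degree (inr u : vertex N) = 3%N) ->
    (forall u : ivertex N, white u -> indeg (inr u : vertex N) = 1%N) ->
    (forall u : ivertex N, ~~ white u -> outdeg (inr u : vertex N) = 1%N) ->
  edge_relations l B E <->
  sink_relations B E /\ forall u, vertex_relation E u.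
Proof.
move=> deg win bout.
have out1 u : degree (inr u : vertex N) = 2%N \/ ~~ white u ->
    outdeg (inr u : vertex N) = 1%N.
  have [wu|bu] := boolP (white u); last by move=> _; exact: bout.
  by case=> //; rewrite /degree win // => -[].
have out2 u : degree (inr u : vertex N) = 3%N -> white u ->
    outdeg (inr u : vertex N) = 2%N.
  by move=> + wu; rewrite /degree win // => -[].
split=> [[sink bib tri]|[sink vr]].
  split=> // u e eu.
  have [wu|bu] := boolP (white u); first case: (deg u) => du.
  - have /mem_card1[f fE] := out1 u (or_introl du).
    rewrite (big_pred1 f) => [|g]; last by have := fE g; rewrite !inE.
    apply: (bib u) => //; first by left.
    by apply/eqP; have := fE f; rewrite !inE eqxx.
  - have [f [g [fg fgE]]] := card2_pred2 (out2 u du wu).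
    have fu : src f = inr u by apply/eqP; have := fgE f; rewrite !inE eqxx.
    have gu : src g = inr u by apply/eqP; have := fgE g; rewrite !inE eqxx orbT.
    rewrite (bigD1 f) ?fu ?eqxx //= (big_pred1 g); first exact: (tri u).
    move=> h; have := fgE h; rewrite !inE => ->.
    have [->|hf] := eqVneq h f; last by rewrite orFb andbT.
    by rewrite andbF; apply/esym/negP => /eqP E1; rewrite E1 eqxx in fg.
  - have /mem_card1[f fE] := out1 u (or_intror bu).
    rewrite (big_pred1 f) => [|g]; last by have := fE g; rewrite !inE.
    apply: (bib u) => //; first by right.
    by apply/eqP; have := fE f; rewrite !inE eqxx.
split=> //.
- move=> u e f /out1 /mem_card1[g gE] eu fu.
  rewrite (vr u e eu) (big_pred1 f) // => h; have := gE h; rewrite !inE => ->.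
  by have := gE f; rewrite !inE fu eqxx => /esym/eqP ->.
- move=> u e3 e1 e2 du wu e3u e1u e2u e12.
  have [f [g [fg fgE]]] := card2_pred2 (out2 u du wu).
  rewrite (vr u e3 e3u) (bigD1 e1) ?e1u ?eqxx //= (big_pred1 e2) // => h.
  have := fgE h; have := fgE e1; have := fgE e2; rewrite !inE e1u e2u eqxx.
  move=> /esym/orP e2fg /esym/orP e1fg ->.
  case: e1fg => /eqP E1; case: e2fg => /eqP E2; rewrite -?E1 -?E2 in e12 *.
  + by rewrite E1 E2 eqxx in e12.
  + by rewrite E1 E2; have [->|hf] := eqVneq h f; rewrite ?andbT //= (negPf fg).
  + rewrite E1 E2; have [->|hf] := eqVneq h g; rewrite ?andbT ?orbF //= andbF.
    by rewrite eq_sym (negPf fg).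
  + by rewrite E1 E2 eqxx in e12.
Qed.

End VertexRelation.

(** * Transport of the relations to the reversed network *)

Section ReversedRelations.
Variables (R : realType) (k n : nat) (N : network R n).
Hypothesis hN : is_plabic_network k N.
Variable l : R * R.
Hypothesis hl : is_gauge_direction N l.
Variable Q : seq (edge N).
Hypothesis hQ : simple_directed_cycle Q.
Implicit Types (e f h : edge N) (v : vertex N) (E F : edge N -> 'rV[R]_n).

Local Notation N' := (reverse_cycle Q).
Local Notation coef := (@edge_coef R n N l).
Local Notation coef' := (@edge_coef R n N' l).

(** [next Q] matches the cycle edges ending at [v] with those starting there. *)
Lemma cycle_degree v : #|[pred e | (e \in Q) && (tgt e == v)]| =
  #|[pred e | (e \in Q) && (src e == v)]|.
Proof.
have uQ := cycle_uniq hQ.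
rewrite -(fintype.card_image (can_inj (prev_next uQ))); apply: eq_card => e.
apply/mapP/idP => [[f + ->]|].
  by rewrite mem_enum !inE => /andP[fQ]; rewrite (cycle_next hQ) // mem_next fQ.
rewrite inE => /andP[eQ ev]; exists (prev Q e); last by rewrite next_prev.
by rewrite mem_enum !inE mem_prev eQ -(cycle_prev hQ).
Qed.

Lemma indeg_reverse v : @indeg R n N' v = indeg v.
Proof.
rewrite /indeg -(cardID (mem Q)) -[RHS](cardID (mem Q)); congr (_ + _)%N.
  rewrite -[RHS]/#|[pred e | (tgt e == v) && (e \in Q)]|.
  rewrite [RHS](_ : _ = #|[pred e | (e \in Q) && (tgt e == v)]|); last first.
    by apply: eq_card => e; rewrite !inE andbC.
  rewrite cycle_degree; apply: eq_card => e; rewrite !inE /=.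
  by case: (e \in Q); rewrite ?andbT ?andbF.
by apply: eq_card => e; rewrite !inE /=; case: (e \in Q).
Qed.

Lemma outdeg_reverse v : @outdeg R n N' v = outdeg v.
Proof.
rewrite /outdeg -(cardID (mem Q)) -[RHS](cardID (mem Q)); congr (_ + _)%N.
  rewrite [RHS](_ : _ = #|[pred e | (e \in Q) && (src e == v)]|); last first.
    by apply: eq_card => e; rewrite !inE andbC.
  rewrite -cycle_degree; apply: eq_card => e; rewrite !inE /=.
  by case: (e \in Q); rewrite ?andbT ?andbF.
by apply: eq_card => e; rewrite !inE /=; case: (e \in Q).
Qed.

Lemma coef_reverse_off e f : e \notin Q -> f \notin Q -> coef' e f = coef e f.
Proof.
move=> eQ fQ; rewrite /edge_coef /wind !vec_reverse (nb_int_reverse hN l hQ).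
by rewrite /= (negPf eQ) (negPf fQ).
Qed.

Lemma hat_off E e : e \notin Q -> hat_vectors l Q E e = (-1) ^ gamma l Q e *: E e.
Proof. by rewrite /hat_vectors => /negPf ->. Qed.

Lemma hat_on E e : e \in Q ->
  hat_vectors l Q E e = ((-1) ^ gamma l Q e / weight e) *: E e.
Proof. by rewrite /hat_vectors => ->. Qed.

Lemma sink_relations_reverse B E :
  sink_relations l (N := N) B E <->
  sink_relations l (N := N') B (hat_vectors l Q E).
Proof.
have sinkE e j : tgt e = inl j -> e \notin Q /\ gamma l Q e = 0.
  move=> ej; have eQ : e \notin Q.
    by apply/negP => /(cycle_tgt_internal hN hQ)[u]; rewrite ej.
  split=> //; rewrite (gamma_off_tgt hN) //.
    case: asboolP => //; rewrite ej => H; by case: (boundary_external hN H).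
  by rewrite ej; exact: (boundary_off_cycle hN hQ).
have sinkE' e j : @tgt R n N' e = inl j -> e \notin Q /\ tgt e = inl j.
  rewrite /=; case: ifP => // eQ.
  by have [u ->] := cycle_src_internal hN hQ eQ.
have off e : e \notin Q -> gamma l Q e = 0 -> hat_vectors l Q E e = E e.
  by move=> eQ g0; rewrite hat_off // g0 expr0z scale1r.
split=> H e j.
  move=> /sinkE'[eQ ej]; have [_ g0] := sinkE _ _ ej.
  by rewrite off // (nb_int_reverse hN l hQ) /= (negPf eQ) (H _ _ ej).
move=> ej; have [eQ g0] := sinkE _ _ ej.
have := H e j; rewrite /= (negPf eQ) => /(_ ej).
by rewrite off // (nb_int_reverse hN l hQ).
Qed.

Variable b : bool.
Hypothesis hb : left_is_internal Q b.

Lemma vertex_relation_off E (u : ivertex N) :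
    ~ cycle_curve Q (pos (inr u : vertex N)) ->
  vertex_relation l (N := N) E u <->
  vertex_relation l (N := N') (hat_vectors l Q E) u.
Proof.
move=> nc.
have srcQ e : src e = inr u -> e \notin Q.
  by move=> eu; apply/negP => eQ; apply: nc; rewrite -eu; exact: curve_src.
have tgtQ e : tgt e = inr u -> e \notin Q.
  by move=> eu; apply/negP => eQ; apply: nc; rewrite -eu; exact: curve_tgt.
set g : int := `[< internal_region Q (pos (inr u : vertex N)) >].
have hat_src e : src e = inr u -> hat_vectors l Q E e = (-1) ^ g *: E e.
  move=> eu; rewrite hat_off ?srcQ // gamma_off_src ?srcQ ?eu //.
have hat_tgt e : tgt e = inr u -> hat_vectors l Q E e = (-1) ^ g *: E e.
  move=> eu; rewrite hat_off ?tgtQ // (gamma_off_tgt hN) ?tgtQ ?eu //.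
have srcE e : (@src R n N' e == inr u) = (src e == inr u).
  rewrite /=; case: ifP => // eQ; apply/eqP/eqP => eu.
    by have := tgtQ _ eu; rewrite eQ.
  by have := srcQ _ eu; rewrite eQ.
have tgtE e : @tgt R n N' e = inr u <-> tgt e = inr u.
  rewrite /=; case: ifP => // eQ; split=> eu.
    by have := srcQ _ eu; rewrite eQ.
  by have := tgtQ _ eu; rewrite eQ.
have sumE e : tgt e = inr u ->
    \sum_(f | @src R n N' f == inr u) coef' e f *: hat_vectors l Q E f =
    (-1) ^ g *: \sum_(f | src f == inr u) coef e f *: E f.
  move=> eu; rewrite scaler_sumr; apply: eq_big => [f|f]; first exact: srcE.
  rewrite srcE => /eqP fu; rewrite hat_src // (coef_reverse_off (tgtQ _ eu) (srcQ _ fu)).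
  by rewrite !scalerA mulrC.
split=> H e.
  by move=> /tgtE eu; rewrite sumE // hat_tgt // (H e eu).
move=> eu; have := H e; rewrite sumE // hat_tgt // => /(_ ((tgtE e).2 eu)).
exact: (scalerI (signrz_neq0 _ _)).
Qed.

Lemma alpha_neq0 e f : e \in Q -> f \in Q -> tgt e = src f -> alpha l Q e f != 0.
Proof.
move=> eQ fQ ef; apply/negP => /eqP a0.
have := alpha_coef hN hl hQ hb eQ fQ ef; rewrite a0 mul0r => /esym/eqP.
by rewrite mulf_eq0 invr_eq0 (negPf (signrz_neq0 _ _)) (negPf (weight_neq0 hN f)).
Qed.

Section CycleVertex.
Variables (u : ivertex N) (e0 f0 : edge N).
Hypotheses (e0Q : e0 \in Q) (f0Q : f0 \in Q).
Hypotheses (e0u : tgt e0 = inr u) (f0u : src f0 = inr u).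

Let ef : tgt e0 = src f0. Proof. by rewrite e0u f0u. Qed.

Lemma cycle_src_eq e : src e = inr u -> (e \in Q) = (e == f0).
Proof.
move=> eu; apply/idP/eqP => [eQ|-> //].
by apply: (cycle_src_inj hQ) => //; rewrite eu.
Qed.

Lemma cycle_tgt_eq e : tgt e = inr u -> (e \in Q) = (e == e0).
Proof.
move=> eu; apply/idP/eqP => [eQ|-> //].
by apply: (cycle_tgt_inj hQ) => //; rewrite eu.
Qed.

Lemma src_reverse e : (@src R n N' e == inr u) =
  (e == e0) || ((src e == inr u) && (e != f0)).
Proof.
rewrite /=; case: ifPn => eQ.
  have [->|ne] := eqVneq e e0; first by rewrite e0u eqxx.
  apply/eqP/andP => [eu|[/eqP eu]]; first by have := cycle_tgt_eq eu; rewrite eQ (negPf ne).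
  by rewrite -(cycle_src_eq eu) eQ.
have -> : (e == e0) = false by apply/negP => /eqP E1; rewrite E1 e0Q in eQ.
by have [E1|_] := eqVneq e f0; rewrite ?andbT //; rewrite E1 f0Q in eQ.
Qed.

Lemma tgt_reverse e : (@tgt R n N' e == inr u) =
  (e == f0) || ((tgt e == inr u) && (e != e0)).
Proof.
rewrite /=; case: ifPn => eQ.
  have [->|ne] := eqVneq e f0; first by rewrite f0u eqxx.
  apply/eqP/andP => [eu|[/eqP eu]]; first by have := cycle_src_eq eu; rewrite eQ (negPf ne).
  by rewrite -(cycle_tgt_eq eu) eQ.
have -> : (e == f0) = false by apply/negP => /eqP E1; rewrite E1 f0Q in eQ.
by have [E1|_] := eqVneq e e0; rewrite ?andbT //; rewrite E1 e0Q in eQ.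
Qed.

(** The only incoming edge is [e0] before the reversal and [f0] after it. The relation of [e0] is
    solved for the term of [f0] and multiplied by the nonzero factor [alpha]. *)
Lemma vertex_relation_white E : white u ->
  vertex_relation l (N := N) E u <->
  vertex_relation l (N := N') (hat_vectors l Q E) u.
Proof.
move=> wu.
have inE0 e : tgt e = inr u -> e = e0.
  have /mem_card1[g gE] := pn_white hN wu.
  move=> eu; have := gE e; have := gE e0; rewrite !inE eu e0u eqxx.
  by move=> /esym/eqP -> /esym/eqP ->.
have inE1 e : @tgt R n N' e = inr u -> e = f0.
  move=> /eqP; rewrite tgt_reverse => /orP[/eqP //|/andP[/eqP /inE0 ->]].
  by rewrite eqxx.
have a0 := alpha_neq0 e0Q f0Q ef.
pose S := \sum_(f | (src f == inr u) && (f != f0)) coef e0 f *: E f.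
have sumE : \sum_(f | src f == inr u) coef e0 f *: E f = coef e0 f0 *: E f0 + S.
  by rewrite (bigD1 f0) // f0u eqxx.
have sumE' : \sum_(f | @src R n N' f == inr u) coef' f0 f *: hat_vectors l Q E f =
    alpha l Q e0 f0 *: (E e0 - S).
  rewrite (bigD1 e0) ?src_reverse ?eqxx //= hat_on // scalerA -/(alpha l Q e0 f0).
  rewrite scalerBr -scaleNr scaler_sumr; congr (_ + _).
  have e0f0 : e0 != f0 by exact: (cycle_consecutive_neq hN ef).
  apply: eq_big => [f|f].
    rewrite src_reverse; have [->|ne] := eqVneq f e0; last by rewrite orFb andbT.
    rewrite andbF e0f0 andbT; apply/esym/negP => /eqP E1.
    by have := cycle_src_eq E1; rewrite e0Q (negPf e0f0).
  rewrite src_reverse => /andP[+ ne]; rewrite (negPf ne) orFb => /andP[/eqP fu nf].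
  have fQ : f \notin Q by rewrite (cycle_src_eq fu).
  rewrite hat_off // !scalerA; congr (_ *: _).
  by rewrite (alpha_out hN hl hQ hb e0Q f0Q ef fQ) ?mulNr // fu f0u.
have hatf0 : hat_vectors l Q E f0 = alpha l Q e0 f0 *: (coef e0 f0 *: E f0).
  by rewrite hat_on // scalerA (alpha_coef hN hl hQ hb).
split=> H e.
  move=> /inE1 ->; rewrite sumE' hatf0; congr (_ *: _).
  by rewrite (H e0 e0u) sumE addrK.
move=> /inE0 ->; rewrite sumE.
have /eqP f0u' : @tgt R n N' f0 == inr u by rewrite tgt_reverse eqxx.
have := H f0 f0u'; rewrite sumE' hatf0 => /(scalerI a0) ->.
by rewrite subrK.
Qed.

(** Up to [alpha], the relation of [e0] becomes that of [f0]. For a third edge the two relations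
    match only once [E e0] is expressed through [E f0], so that relation is obtained first in both
    directions. *)
Lemma vertex_relation_black E : ~~ white u ->
  vertex_relation l (N := N) E u <->
  vertex_relation l (N := N') (hat_vectors l Q E) u.
Proof.
move=> bu.
have outE0 e : (src e == inr u) = (e == f0).
  have /mem_card1[g gE] := pn_black hN bu.
  have := gE e; have := gE f0; rewrite !inE f0u eqxx.
  by move=> /esym/eqP -> ->.
have outE1 e : (@src R n N' e == inr u) = (e == e0).
  by rewrite src_reverse outE0; case: (e == f0); rewrite ?orbF.
have sumE e : \sum_(f | src f == inr u) coef e f *: E f = coef e f0 *: E f0.
  by rewrite (big_pred1 f0).
have sumE' e : \sum_(f | @src R n N' f == inr u) coef' e f *: hat_vectors l Q E f =
    coef' e e0 *: hat_vectors l Q E e0.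
  by rewrite (big_pred1 e0).
have a0 := alpha_neq0 e0Q f0Q ef.
have hatf0 : hat_vectors l Q E f0 = alpha l Q e0 f0 *: (coef e0 f0 *: E f0).
  by rewrite hat_on // scalerA (alpha_coef hN hl hQ hb).
have hate0 : coef' f0 e0 *: hat_vectors l Q E e0 = alpha l Q e0 f0 *: E e0.
  by rewrite hat_on // scalerA.
have third h : tgt h = inr u -> h != e0 -> E e0 = coef e0 f0 *: E f0 ->
    coef' h e0 *: hat_vectors l Q E e0 = (-1) ^ gamma l Q h *: (coef h f0 *: E f0).
  move=> hu hne Ee0; have hQn : h \notin Q by rewrite (cycle_tgt_eq hu).
  rewrite hat_on // Ee0 !scalerA; congr (_ *: _).
  by rewrite (alpha_in hN hl hQ hb e0Q f0Q ef hQn) // hu f0u.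
split=> H e.
  have Ee0 : E e0 = coef e0 f0 *: E f0 by rewrite (H e0 e0u) sumE.
  move=> /eqP; rewrite tgt_reverse sumE' => /orP[/eqP ->|/andP[/eqP eu ne]].
    by rewrite hatf0 hate0 Ee0.
  by rewrite third // hat_off ?(cycle_tgt_eq eu) // (H e eu) sumE.
have Ee0 : E e0 = coef e0 f0 *: E f0.
  have /eqP f0u' : @tgt R n N' f0 == inr u by rewrite tgt_reverse eqxx.
  by have := H f0 f0u'; rewrite sumE' hatf0 hate0 => /(scalerI a0).
move=> eu; rewrite sumE; have [->//|ne] := eqVneq e e0.
have /eqP eu' : @tgt R n N' e == inr u by rewrite tgt_reverse eu eqxx ne orbT.
have := H e eu'; rewrite sumE' third // hat_off ?(cycle_tgt_eq eu) //.
exact: (scalerI (signrz_neq0 _ _)).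
Qed.

End CycleVertex.

Lemma vertex_relation_reverse E (u : ivertex N) :
  vertex_relation l (N := N) E u <->
  vertex_relation l (N := N') (hat_vectors l Q E) u.
Proof.
have [|nc] := pselect (cycle_curve Q (pos (inr u : vertex N))); last first.
  exact: vertex_relation_off.
move=> /(curve_vertex hN hQ)[f0 f0Q f0u].
have e0Q : prev Q f0 \in Q by rewrite mem_prev.
have e0u : tgt (prev Q f0) = inr u by rewrite -(cycle_prev hQ).
have [wu|bu] := boolP (white u).
  exact: (vertex_relation_white e0Q f0Q e0u f0u).
exact: (vertex_relation_black e0Q f0Q e0u f0u).
Qed.

Lemma edge_relations_reverse B E :
  edge_relations l (N := N) B E <->
  edge_relations l (N := N') B (hat_vectors l Q E).
Proof.
rewrite !edge_relationsE.
- split=> -[hs hv]; split; try exact/sink_relations_reverse.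
    by move=> u; apply/vertex_relation_reverse.
  by move=> u; apply/vertex_relation_reverse.
- by move=> u; rewrite /degree indeg_reverse outdeg_reverse; exact: pn_internal_degree hN u.
- by move=> u wu; rewrite indeg_reverse; exact: (@pn_white _ _ _ _ hN u wu).
- by move=> u wu; rewrite outdeg_reverse; exact: (@pn_black _ _ _ _ hN u wu).
- exact: pn_internal_degree hN.
- exact: pn_white hN.
- exact: pn_black hN.
Qed.

Lemma hat_vectors_surj (F : edge N -> 'rV[R]_n) : exists E, hat_vectors l Q E = F.
Proof.
exists (fun e => (if e \in Q then weight e * (-1) ^ gamma l Q e
                  else (-1) ^ gamma l Q e) *: F e).
apply/funext => e; rewrite /hat_vectors; have [eQ|eQ] := boolP (e \in Q).
  rewrite scalerA mulrA divfK ?signrz_sq ?scale1r //; exact: (weight_neq0 hN).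
by rewrite scalerA signrz_sq scale1r.
Qed.

End ReversedRelations.

Theorem lemma5p7 (R : realType) (k n : nat) (hk : (0 < k)%N) (hkn : (k < n)%N)
    (N : network R n) (hN : is_plabic_network k N)
    (l : R * R) (hl : is_gauge_direction N l)
    (E : edge N -> 'rV[R]_n)
    (hE : is_edge_vector_system l (@canonical_vector R n) E)
    (Q : seq (edge N)) (hQ : simple_directed_cycle Q) :
  @is_edge_vector_system R n (reverse_cycle Q) l (@canonical_vector R n)
    (hat_vectors l Q E).
Proof.
have [b hb] := cycle_sides hN hl hQ.
case: hE => hE uE; split.
  exact/(edge_relations_reverse hN hl hQ hb).
move=> F hF; have [E' E'F] := hat_vectors_surj hN l Q F.
rewrite -E'F; congr (hat_vectors l Q _); apply: uE.
by apply/(edge_relations_reverse hN hl hQ hb); rewrite E'F.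
Qed.
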